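(* Let $\overline S\subset\mathcal L_0$ be a model and let $\mathcal R_\rho(\overline S)$ be as defined in the context. (1) If $\overline S$, viewed as a set of real-valued functions on $\overline{\mathcal X}$, is VC-subgraph with index $\overline V$, then $$R_M(\overline S)\le\mathcal R_\rho(\overline S)\le c_4+C\,\overline V\big[1+\log_+(n/\overline V)\big]$$ for some universal constant $C>0$. (2) If $\overline S$ is a totally bounded nonempty subset of $\mathcal L_0$ with metric dimension bounded by $\widetilde D(\cdot)$, then $$R_M(\overline S)\le\mathcal R_\rho(\overline S)\le c_4+2(c_1+2c_2)\overline\eta^2\quad\text{with}\quad\overline\eta=\inf\big\{\eta>0:\eta^{-2}\widetilde D(\eta)\le8c_0^2/131\big\}.$$
   Context: Setting. Let $n\ge3$. For $1\le i\le n$, $(\mathcal X_i,\mathcal A_i,\mu_i)$ is a measured space and $\mathcal L_i$ is the set of probability densities with respect to $\mu_i$; $\mathcal L_0=\prod_{i=1}^n\mathcal L_i$, with elements $\mathbf t=(t_1,\dots,t_n)$. $\boldsymbol X=(X_1,\dots,X_n)$ is a vector of independent random variables, $X_i$ having values in $\mathcal X_i$ and density $s_i$ with respect to $\mu_i$; $\mathbf s=(s_1,\dots,s_n)$, and $\mathbb P_{\mathbf s},\mathbb E_{\mathbf s}$ denote probability and expectation for this distribution. For densities $u,v\in\mathcal L_i$, $h^2(u,v)=\frac12\int(\sqrt u-\sqrt v)^2d\mu_i$ and $\rho(u,v)=\int\sqrt{uv}\,d\mu_i$; for $\mathbf t,\mathbf t'\in\mathcal L_0$, $\mathbf h^2(\mathbf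 t,\mathbf t')=\sum_{i=1}^nh^2(t_i,t_i')$ and $\mathbf h(\mathbf t,S)=\inf_{\mathbf u\in S}\mathbf h(\mathbf t,\mathbf u)$; $\mathcal B(\mathbf t,y)$ is the closed $\mathbf h$-ball in $\mathcal L_0$ with center $\mathbf t$ and radius $y$. $S\subset\mathcal L_0$ is identifiable if $\mathbf h(\mathbf u,\mathbf u')>0$ for all distinct $\mathbf u,\mathbf u'\in S$. A model is a nonempty separable subset of $(\mathcal L_0,\mathbf h)$. ''Countable'' means finite or countable. Conventions: $0/0=1$, $x/0=+\infty$ for $x>0$, $0\times(+\infty)=0$, $\sup\varnothing=0$, $\log_+x=\max\{\log x,0\}$. Constants: $c_0=\frac18(1-\frac1{\sqrt2})$, $c_1=2(7+4\sqrt2)$, $c_1'=2(c_1-1)$, $c_2=1+\frac1{\sqrt2}$, $\kappa=357$, $c_3=8\kappa c_2$, $c_4=2.5c_3$. $\rho$-estimators. Let $\psi(u)=\frac{u-1}{\sqrt{1+u^2}}$ for $u\in[0,+\infty)$ and $\psi(+\infty)=1$. For $\mathbf t,\mathbf t'\in\mathcal L_0$ and $\mathbf r=(\mathbf t+\mathbf t')/2$, $\mathbf T(\boldsymbol X,\mathbf t,\mathbf t')=\frac12\sum_{i=1}^n[\rho(t_i',r_i)-\rho(t_i,r_i)]+\frac1{\sqrt2}\sum_{i=1}^n\psi\big(\sqrt{t_i'/t_i}(X_i)\big)$. For a countable identifiable $S\subset\mathcal L_0$, $\boldsymbol\Upsilon(S,\mathbf t)=\sup_{\mathbf t'\in S}\mathbf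 T(\boldsymbol X,\mathbf t,\mathbf t')$ and $\mathcal E(\boldsymbol X,S)=\{\widetilde{\mathbf s}\in S:\boldsymbol\Upsilon(S,\widetilde{\mathbf s})\le\inf_{\mathbf t\in S}\boldsymbol\Upsilon(S,\mathbf t)+\kappa/10\}$. A $\rho$-estimator based on $S$ is any element $\widehat{\mathbf s}=\widehat{\mathbf s}(\boldsymbol X)$, chosen in a measurable way, of $\mathrm{Cl}(\mathcal E(\boldsymbol X,S))=\{\mathbf t\in\mathcal L_0:\mathbf h(\mathbf t,\mathcal E(\boldsymbol X,S))=0\}$. Dimension of a model. $\mathbf Z(\boldsymbol X,\mathbf t,\mathbf t')=\sum_{i=1}^n\{\psi(\sqrt{t_i'/t_i}(X_i))-\mathbb E_{\mathbf s}[\psi(\sqrt{t_i'/t_i}(X_i))]\}$. For countable $S\subset\mathcal L_0$, $\overline{\mathbf s}\in\mathcal L_0$, $y\geq 0$: $\mathcal B^S(\mathbf s,\overline{\mathbf s},y)=\{\mathbf t\in S:\mathbf h^2(\mathbf s,\mathbf t)+\mathbf h^2(\mathbf s,\overline{\mathbf s})\le y^2\}$, $\mathbf w^S(\mathbf s,\overline{\mathbf s},y)=\mathbb E_{\mathbf s}[\sup_{\mathbf t\in\mathcal B^S(\mathbf s,\overline{\mathbf s},y)}|\mathbf Z(\boldsymbol X,\overline{\mathbf s},\mathbf t)|]$ ($0$ if the set is empty), $D^S(\mathbf s,\overline{\mathbf s})=\overline y^2\vee1$ with $\overline y=\sup\{y\ge0:\mathbf w^S(\mathbf s,\overline{\mathbf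 s},y)>c_0y^2\}$, $D^S=\sup_{(\mathbf s,\overline{\mathbf s})\in\mathcal L_0\times S}D^S(\mathbf s,\overline{\mathbf s})$, and $D(\overline S)=\inf_S[2c_1\sup_{\mathbf u\in\overline S}\mathbf h^2(\mathbf u,S)+c_2D^S]$, the infimum being over all countable identifiable $S\subset\mathcal L_0$. Risks. $R_M(\overline S)=\inf_{\widetilde{\mathbf s}}\sup_{\mathbf s\in\overline S}\mathbb E_{\mathbf s}[\mathbf h^2(\mathbf s,\widetilde{\mathbf s})]$, the infimum over all estimators. $\mathcal R_\rho(\overline S)=\sup_{\mathbf s\in\overline S}\mathbb E_{\mathbf s}[\mathbf h^2(\mathbf s,\widehat{\mathbf s})]$ where $\widehat{\mathbf s}$ is any $\rho$-estimator (based on some countable identifiable subset of $\mathcal L_0$) satisfying $\mathbb E_{\mathbf s}[\mathbf h^2(\mathbf s,\widehat{\mathbf s})]\le c_1'\mathbf h^2(\mathbf s,\overline S)+D(\overline S)+c_4$ for all $\mathbf s\in\mathcal L_0$; such $\rho$-estimators exist for every model. VC-subgraph. $\mathbf t\in\mathcal L_0$ is viewed as a function on $\overline{\mathcal X}=\bigcup_{i=1}^n(\{i\}\times\mathcal X_i)$ by $\mathbf t(i,x)=t_i(x)$. A class $\mathcal F$ of functions from a set $\Xi$ to $(-\infty,+\infty]$ is VC-subgraph with index $\overline V$ if the class of subgraphs $\{(x,u)\in\Xi\times\mathbb R:f(x)>u\}$, $f\in\mathcal F$, is a VC-class with finite VC-index $\overline V$, i.e. $\overline V$ is the smallest integer $m$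 such that no set of $m$ points is shattered. Metric dimension. For $\eta\ge 0$, an $\eta$-net for $\overline S$ is a countable $S[\eta]\subset\mathcal L_0$ (not necessarily included in $\overline S$) with $\sup_{\mathbf t\in\overline S}\mathbf h(\mathbf t,S[\eta])\le\eta$. Let $\widetilde D$ be a right-continuous function from $(0,+\infty)$ to $[1/2,+\infty]$ with $\widetilde D(\eta)=1/2$ for $\eta\ge\sqrt n$. $\overline S$ has metric dimension bounded by $\widetilde D(\cdot)$ if for all $\eta>0$ there is an $\eta$-net $S[\eta]$ for $\overline S$ such that $\sup_{\mathbf s\in\mathcal L_0}\log|S[\eta]\cap\mathcal B(\mathbf s,y)|\le(y/\eta)^2\widetilde D(\eta)$ for all $y\ge2\eta$. *)

(* Defs.v *)
From HB Require Import structures.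
From mathcomp Require Import all_boot all_order all_algebra.
From mathcomp Require Import all_classical all_reals all_analysis.

Set Implicit Arguments.
Unset Strict Implicit.
Unset Printing Implicit Defensive.

Import Order.TTheory GRing.Theory Num.Theory.
Import numFieldNormedType.Exports.

Local Open Scope classical_set_scope.
Local Open Scope ring_scope.

Section constants.
Variable R : realType.

Definition c0 : R := 8^-1 * (1 - (Num.sqrt 2)^-1).
Definition c1 : R := 2 * (7 + 4 * Num.sqrt 2).
Definition c1' : R := 2 * (c1 - 1).
Definition c2 : R := 1 + (Num.sqrt 2)^-1.
Definition kappa : R := 357.
Definition c3 : R := 8 * kappa * c2.
Definition c4 : R := 5 / 2 * c3.

Definition logp (x : R) : R := Num.max (ln x) 0.

(* supremum with the convention sup set0 = 0; infima keep ereal_inf set0 = +oo *)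
Definition esup (A : set (\bar R)) : \bar R :=
  if A == set0 then 0%E else ereal_sup A.

(* a / b for a, b >= 0, with 0 / 0 = 1 and a / 0 = +oo for a > 0 *)
Definition ediv (a b : R) : \bar R :=
  if b == 0 then (if a == 0 then 1%E else +oo%E) else (a / b)%:E.

(* psi is only applied to [0, +oo]; the value at -oo is irrelevant *)
Definition psi (u : \bar R) : R :=
  match u with
  | r%:E => (r - 1) / Num.sqrt (1 + r ^+ 2)
  | +oo%E => 1
  | -oo%E => -1
  end.

End constants.

Section vc.

Definition shatters (T : Type) (C : set (set T)) (A : set T) : Prop :=
  forall B, B `<=` A -> exists2 c, C c & c `&` A = B.

Definition vc_index (T : Type) (C : set (set T)) (V : nat) : Prop :=
  (~ exists A, (A #= `I_V)%card /\ shatters C A) /\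
  (forall m, (m < V)%N -> exists A, (A #= `I_m)%card /\ shatters C A).

Definition subgraph (R : realType) (T : Type) (f : T -> \bar R) : set (T * R) :=
  [set p | (p.2%:E < f p.1)%E].

Definition vc_subgraph_index (R : realType) (T : Type) (F : set (T -> \bar R))
    (V : nat) : Prop :=
  vc_index [set subgraph f | f in F] V.

End vc.

Section sample_space.
Variables (n : nat) (d : 'I_n -> measure_display).
Variable X : forall i, measurableType (d i).

Definition prodX : Type := forall i, X i.

Definition cylinders : set (set prodX) :=
  [set B | exists i (A : set (X i)), measurable A /\ B = [set x | A (x i)]].

(* the product of the measurable spaces X i; the random vector is the identity
   map on it *)
Definition sampleType := g_sigma_algebraType cylinders.

End sample_space.

Section model.
Variables (R : realType) (n : nat) (d : 'I_n -> measure_display).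
Variable X : forall i, measurableType (d i).
Variable mu : forall i, {measure set (X i) -> \bar R}.

Definition is_density i (f : X i -> R) : Prop :=
  [/\ measurable_fun setT f, forall x, 0 <= f x &
      (\int[mu i]_x (f x)%:E = 1)%E].

(* densities are genuine functions, not classes modulo equality mu-a.e. *)
Definition dens : Type := forall i, X i -> R.

Definition L0 : set dens := [set t | forall i, is_density (t i)].

Definition hsq1 i (u v : X i -> R) : R :=
  2^-1 * \int[mu i]_x (Num.sqrt (u x) - Num.sqrt (v x)) ^+ 2.

Definition rho1 i (u v : X i -> R) : R :=
  \int[mu i]_x Num.sqrt (u x * v x).

Definition hsq (t t' : dens) : R := \sum_(i < n) hsq1 (t i) (t' i).

Definition hdist (t t' : dens) : R := Num.sqrt (hsq t t').

Definition hset (t : dens) (S : set dens) : \bar R :=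
  ereal_inf [set (hdist t u)%:E | u in S].

Definition hball (t : dens) (y : R) : set dens :=
  [set u | L0 u /\ hdist t u <= y].

Definition hopen (U : set dens) : Prop :=
  U `<=` L0 /\
  forall t, U t -> exists2 e : R, 0 < e & forall u, L0 u -> hdist t u < e -> U u.

Definition identifiable (S : set dens) : Prop :=
  forall u u', S u -> S u' -> u <> u' -> 0 < hdist u u'.

Definition countable_identifiable (S : set dens) : Prop :=
  [/\ S `<=` L0, countable S & identifiable S].

Definition hseparable (S : set dens) : Prop :=
  exists D, [/\ D `<=` S, countable D &
    forall t, S t -> forall e : R, 0 < e -> exists2 u, D u & hdist t u < e].

Definition is_model (S : set dens) : Prop :=
  [/\ S `<=` L0, S !=set0 & hseparable S].

Definition htotally_bounded (S : set dens) : Prop :=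
  forall e : R, 0 < e -> exists F, [/\ F `<=` S, finite_set F &
    forall t, S t -> exists2 u, F u & hdist t u < e].

Definition flat (t : dens) : {i : 'I_n & X i} -> \bar R :=
  fun p => (t (projT1 p) (projT2 p))%:E.

(* P is the law of (X_1, ..., X_n) with independent coordinates, X_i having
   density s i with respect to mu i *)
Definition is_law (s : dens) (P : probability (sampleType X) R) : Prop :=
  forall A : (forall i, set (X i)), (forall i, measurable (A i)) ->
    P [set x | forall i, A i (x i)]
    = (\prod_(i < n) \int[mu i]_(x in A i) (s i x)%:E)%E.

(* estimators, as functions of the observation, are measurable for the product
   sigma-algebra and the Borel sigma-algebra of (L0, hdist) *)
Definition is_estimator (est : sampleType X -> dens) : Prop :=
  (forall x, L0 (est x)) /\
  (forall U, hopen U -> measurable (est @^-1` U)).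

Definition psi_ratio (t t' : dens) (x : sampleType X) (i : 'I_n) : R :=
  psi (sqrte (ediv (t' i (x i)) (t i (x i)))).

Definition Tstat (x : sampleType X) (t t' : dens) : R :=
  let r i y := (t i y + t' i y) / 2 in
  2^-1 * (\sum_(i < n) (rho1 (t' i) (r i) - rho1 (t i) (r i)))
  + (Num.sqrt 2)^-1 * \sum_(i < n) psi_ratio t t' x i.

Definition Upsilon (x : sampleType X) (S : set dens) (t : dens) : \bar R :=
  esup [set (Tstat x t t')%:E | t' in S].

Definition calE (x : sampleType X) (S : set dens) : set dens :=
  [set st | S st /\
    (Upsilon x S st <=
      ereal_inf [set Upsilon x S t | t in S] + (kappa R / 10)%:E)%E].

Definition Cl (E : set dens) : set dens := [set t | L0 t /\ hset t E = 0%E].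

Definition is_rho_estimator (S : set dens) (est : sampleType X -> dens) : Prop :=
  [/\ countable_identifiable S, is_estimator est &
      forall x, Cl (calE x S) (est x)].

(* P s is the law of the observation when its density is s *)
Variable P : dens -> probability (sampleType X) R.

Definition Zproc (s t t' : dens) (x : sampleType X) : R :=
  \sum_(i < n) (psi_ratio t t' x i - \int[P s]_z psi_ratio t t' z i).

Definition BS (S : set dens) (s sb : dens) (y : R) : set dens :=
  [set t | S t /\ hsq s t + hsq s sb <= y ^+ 2].

Definition wS (S : set dens) (s sb : dens) (y : R) : \bar R :=
  (\int[P s]_x esup [set `|Zproc s sb t x|%:E | t in BS S s sb y])%E.

Definition ybar (S : set dens) (s sb : dens) : \bar R :=
  esup [set y%:E | y in [set y : R | 0 <= y /\
                          ((c0 R * y ^+ 2)%:E < wS S s sb y)%E]].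

Definition DS2 (S : set dens) (s sb : dens) : \bar R :=
  maxe (ybar S s sb ^+ 2)%E 1%E.

Definition DS (S : set dens) : \bar R :=
  esup [set DS2 S s sb | s in L0 & sb in S].

Definition Dmodel (Sb : set dens) : \bar R :=
  ereal_inf [set ((2 * c1 R)%:E * esup [set (hset u S ^+ 2)%E | u in Sb]
                  + (c2 R)%:E * DS S)%E | S in countable_identifiable].

Definition risk (s : dens) (est : sampleType X -> dens) : \bar R :=
  (\int[P s]_x (hsq s (est x))%:E)%E.

Definition max_risk (Sb : set dens) (est : sampleType X -> dens) : \bar R :=
  esup [set risk s est | s in Sb].

Definition minimax_risk (Sb : set dens) : \bar R :=
  ereal_inf [set max_risk Sb est | est in is_estimator].

(* the rho-estimators whose maximal risk over Sb is denoted R_rho(Sb) *)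
Definition risk_rho_estimator (Sb : set dens) (est : sampleType X -> dens)
    : Prop :=
  (exists S, is_rho_estimator S est) /\
  forall s, L0 s ->
    (risk s est <=
      (c1' R)%:E * hset s Sb ^+ 2 + Dmodel Sb + (c4 R)%:E)%E.

Definition eta_net (eta : R) (Sb N : set dens) : Prop :=
  [/\ N `<=` L0, countable N &
      (esup [set hset t N | t in Sb] <= eta%:E)%E].

Definition dimension_function (Dt : R -> \bar R) : Prop :=
  [/\ forall eta : R, 0 < eta -> (2^-1%:E <= Dt eta)%E,
      forall eta : R, 0 < eta -> Dt x @[x --> eta^'+] --> Dt eta &
      forall eta : R, Num.sqrt n%:R <= eta -> Dt eta = 2^-1%:E].

(* lne (counting A) is the logarithm of the cardinality of A, with values -oo
   for the empty set and +oo for infinite sets *)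
Definition metric_dimension_bounded (Sb : set dens) (Dt : R -> \bar R) : Prop :=
  forall eta : R, 0 < eta -> exists2 N, eta_net eta Sb N &
    forall y, 2 * eta <= y ->
      (esup [set lne (counting (N `&` hball s y)) | s in L0]
        <= ((y / eta) ^+ 2)%:E * Dt eta)%E.

Definition etabar (Dt : R -> \bar R) : R :=
  inf [set eta : R | 0 < eta /\
         ((eta ^- 2)%:E * Dt eta <= (8 * c0 R ^+ 2 / 131)%:E)%E].

End model.

(* Main.v *)
(* On Sbar the approximation term of the risk bound vanishes, so everything
   reduces to bounding the dimension D(Sbar) by a good choice of S.

   Metric dimension: S is an eta-net made identifiable by keeping one element per
   class at distance zero. Since s psi ^ 2 is at most 3 / 2 times the sum of the
   squared differences of square roots, sum_i E psi ^ 2 <= 3 y ^ 2 on the relevant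
   ball, and the bound exp u <= 1 + u + u ^ 2 gives a Bernstein inequality sharp
   enough for the constant 131, for every y >= 2 eta.

   VC-subgraph: S is a countable dense identifiable subset of Sbar. The process is
   symmetrized by swapping coordinates of two independent samples x and z. Given
   (x, z), the functions psi are rounded to the K-point grid, K ~ n / V; the codes
   obtained shatter no set of V points because psi (sqrt (t / sb)) is monotone in t,
   so Sauer's lemma bounds their number by (4 e (n / V) ^ 2) ^ V, and a maximal
   inequality for Rademacher sums over one representative per code concludes. The
   random variance sup_t sum_i psi ^ 2 is handled by the same symmetrization
   applied to psi ^ 2. *)

(* Both cases aim at [wS] <= c0 y^2 for all y^2 > b, which gives D^S <= b. The parameter lam of the
   exponential bounds is chosen so that the variance contributes c0 / 2 y^2; the entropy term has to
   fit in the other half. The obstacle in the VC case is that the class becomes finite only at fixed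
   samples, where the variance at hand is the empirical sup_t sum_i psi^2 and not an expectation at
   each t. Its mean satisfies an inequality in which it appears on both sides, and which can be
   solved because psi^2 <= 1 makes it finite. Jensen's inequality is avoided throughout: a supremum
   is dominated pointwise by an affine function of a sum of exponentials, so only moment generating
   functions have to be computed. *)
Require Import Defs.
From mathcomp Require Import all_boot all_order all_algebra.

Set Implicit Arguments.
Unset Strict Implicit.
Unset Printing Implicit Defensive.

(** * Shattering by finite families and the Sauer-Shelah lemma *)

Section sauer.
Variable T : finType.
Implicit Types (A B J : {set T}) (F : {set {set T}}).

Definition fshatters F J :=
  [forall B : {set T}, (B \subset J) ==> [exists A in F, A :&: J == B]].

Lemma fshattersP F J :
  reflect (forall B, B \subset J -> exists2 A, A \in F & A :&: J = B)
          (fshatters F J).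
Proof.
apply: (iffP forallP) => [h B BJ|h B].
  have /implyP/(_ BJ)/existsP[A /andP[AF /eqP ABJ]] := h B.
  by exists A.
apply/implyP => BJ; have [A AF AJ] := h B BJ.
by apply/existsP; exists A; rewrite AF AJ eqxx.
Qed.

(* Pajor's strengthening of the Sauer-Shelah lemma *)
Lemma card_le_fshatters F : (#|F| <= #|[set J | fshatters F J]|)%N.
Proof.
suff main m A F' : #|A| = m -> (forall B, B \in F' -> B \subset A) ->
    (#|F'| <= #|[set J | fshatters F' J]|)%N.
  by apply: (main #|T| [set: T]); [exact: cardsT|move=> B _; exact: subsetT].
elim: m A F' => [|m IH] A F' cA sF.
  have [->|[B BF]] := set_0Vmem F'; first by rewrite cards0.
  have e B' : B' \in F' -> B' = set0.
    by move=> /sF; move/eqP: cA; rewrite cards_eq0 => /eqP ->; rewrite subset0 => /eqP.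
  apply: (@leq_trans #|[set (set0 : {set T})]|).
    by apply/subset_leq_card/subsetP => B' /e ->; rewrite inE.
  apply/subset_leq_card/subsetP => J; rewrite !inE => /eqP ->.
  apply/fshattersP => B'; rewrite subset0 => /eqP ->.
  by exists B => //; rewrite setI0.
have [a aA] : exists a, a \in A by apply/set0Pn; rewrite -card_gt0 cA.
(* [F0] and [F1] are the traces on [A :\ a] of the members avoiding and containing [a]. Their
   cardinals add up to those of union and intersection. A set shattered by the union is shattered by
   [F']; if [J] is shattered by the intersection, [a |: J] is shattered by [F']. The two kinds
   differ by whether they contain [a]. *)
pose F0 := [set B in F' | a \notin B].
pose F1 := [set B :\ a | B in [set B in F' | a \in B]].
have F0P B : B \in F0 -> B \in F' /\ a \notin B by rewrite inE => /andP.
have F1P B : B \in F1 -> a |: B \in F' /\ a \notin B.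
  move=> /imsetP[B' +->]; rewrite inE => /andP[B'F aB'].
  by rewrite setD1K// setD11.
have cF : #|F'| = (#|F0| + #|F1|)%N.
  rewrite -(cardsID [set B : {set T} | a \notin B] F'); congr addn.
    by apply: eq_card => B; rewrite !inE.
  rewrite card_in_imset => [|B B'].
    by apply: eq_card => B; rewrite !inE negbK andbC.
  rewrite !inE => /andP[_ aB] /andP[_ aB'] e.
  by rewrite -(setD1K aB) -(setD1K aB') e.
have cA' : #|A :\ a| = m.
  by apply/eqP; rewrite -eqSS -cA (cardsD1 a A) aA.
have sub01 B : B \in F0 :|: F1 -> B \subset A :\ a /\ a \notin B.
  rewrite inE => /orP[/F0P[/sF BA aB]|/F1P[/sF BA aB]]; split => //.
    by rewrite subsetD1 BA.
  by rewrite subsetD1 aB andbT (subset_trans _ BA)// subsetU1.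
rewrite cF -cardsUI.
have IHU := IH _ (F0 :|: F1) cA' (fun B h => (sub01 B h).1).
have IHI : (#|F0 :&: F1| <= #|[set J | fshatters (F0 :&: F1) J]|)%N.
  apply: (IH _ _ cA') => B; rewrite inE => /andP[B0 B1].
  by apply: (sub01 B _).1; rewrite inE B0.
have shN (G : {set {set T}}) J : {subset G <= F0 :|: F1} -> fshatters G J ->
    a \notin J.
  move=> GF /fshattersP /(_ J (subxx J))[B /GF/sub01[_ aB] BJ].
  by apply: contra aB => aJ; move: aJ; rewrite -{1}BJ inE => /andP[].
apply: leq_trans (leq_add IHU IHI) _.
rewrite -(cardsID [set J : {set T} | a \notin J] [set J | fshatters F' J]).
apply: leq_add.
  apply/subset_leq_card/subsetP => J; rewrite !inE => shJ.
  have aJ := shN _ J (fun _ h => h) shJ; rewrite aJ andbT.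
  apply/fshattersP => B BJ.
  have /fshattersP/(_ B BJ)[B'] := shJ.
  rewrite inE => /orP[/F0P[B'F _] e|/F1P[B'F _] e]; first by exists B'.
  exists (a |: B') => //; rewrite setIUl e; apply/setUidPr.
  by apply/subsetP => x; rewrite !inE => /andP[/eqP ->]; rewrite (negbTE aJ).
have inj : {in [set J | fshatters (F0 :&: F1) J] &, injective (fun J => a |: J)}.
  have hN J : J \in [set J | fshatters (F0 :&: F1) J] -> a \notin J.
    rewrite inE; apply: shN => B.
    by rewrite [B \in _ :&: _]inE => /andP[B0 _]; rewrite inE B0.
  by move=> J J' /hN aJ /hN aJ' e; rewrite -(setU1K aJ) e setU1K.
rewrite -(card_in_imset inj).
apply/subset_leq_card/subsetP => _ /imsetP[J + ->].
rewrite inE => shJ; rewrite !inE eqxx/=.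
have aJ : a \notin J.
  apply: shN shJ => B.
  by rewrite [B \in _ :&: _]inE => /andP[B0 _]; rewrite inE B0.
apply/fshattersP => B BJ.
have BJ' : B :\ a \subset J.
  apply/subsetP => x; rewrite !inE => /andP[xa xB].
  by move/subsetP/(_ _ xB): BJ; rewrite !inE (negbTE xa).
have /fshattersP/(_ _ BJ')[B'] := shJ.
rewrite inE => /andP[/F0P[B0 aB'] /F1P[B1 _]] e.
have [aB|aB] := boolP (a \in B).
  by exists (a |: B') => //; rewrite -setUIr e setD1K.
exists B' => //; rewrite setIUr e.
have -> : B :\ a = B.
  by apply/setP => x; rewrite !inE; case: eqP => // ->; rewrite (negbTE aB).
apply/setUidPr/subsetP => x; rewrite !inE => /andP[+ /eqP xa].
by rewrite xa (negbTE aB').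
Qed.

Lemma sauer_shelah F V : (forall J, fshatters F J -> (#|J| < V)%N) ->
  (#|F| <= \sum_(k < V) 'C(#|T|, k))%N.
Proof.
move=> hV; apply: leq_trans (card_le_fshatters F) _.
apply: (@leq_trans #|[set J : {set T} | (#|J| < V)%N]|).
  by apply/subset_leq_card/subsetP => J; rewrite !inE => /hV.
elim: V {hV} => [|V IH]; first last.
  rewrite big_ord_recr/= -card_draws; apply: leq_trans (leq_add IH (leqnn _)).
  apply: leq_trans (leq_card_setU _ _); apply/subset_leq_card/subsetP => J.
  by rewrite !inE ltnS leq_eqVlt orbC.
by rewrite big_ord0 leqn0 cards_eq0; apply/eqP/setP => J; rewrite !inE ltn0.
Qed.

End sauer.

From mathcomp Require Import all_classical all_reals all_analysis.
From mathcomp Require Import finmap measurable_realfun ring lra.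

Import Order.TTheory GRing.Theory Num.Theory.
Import numFieldNormedType.Exports.

Local Open Scope classical_set_scope.
Local Open Scope ring_scope.

(** * Elementary inequalities *)

Section real_inequalities.
Variable R : realType.
Implicit Types x y u c : R.

(** With g t = (1 + t + t^2) exp (- t), one has g' t = t (1 - t) exp (- t): on (-oo, 1], g decreases
    to its value 1 at 0 and then increases. *)
Lemma expR_le1DxDsqr x : x <= 1 -> expR x <= 1 + x + x ^+ 2.
Proof.
move=> x1; pose g (t : R) : R := (1 + t + t ^+ 2) * expR (- t).
have dg (t : R) : is_derive t 1 g (t * (1 - t) * expR (- t)).
  apply: is_derive_eq; rewrite /GRing.scale /=.
  by rewrite !(mulr1, expr1); ring.
have cg a b : {within `[a, b], continuous g}.
  apply/continuous_subspaceT => t.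
  by apply/differentiable_continuous/derivable1_diffP/(@ex_derive _ _ _ _ _ _ _ (dg t)).
have ddg (t : R) : derivable g t 1 by exact: (@ex_derive _ _ _ _ _ _ _ (dg t)).
have dgE (t : R) : derive1 g t = t * (1 - t) * expR (- t).
  by rewrite derive1E; apply: (@derive_val _ _ _ _ _ _ _ (dg t)).
suff : 1 <= g x.
  rewrite /g expRN => h; rewrite -[leLHS]mul1r.
  by rewrite -ler_pdivlMr ?expR_gt0.
have g0 : g 0 = 1 by rewrite /g oppr0 expR0 expr0n/=; ring.
have [x0|/ltW x0] := leP 0 x.
  rewrite -g0; apply: (@ger0_derive1_ndecr _ g 0 x) => // t.
  rewrite in_itv/= => /andP[t0 tx]; rewrite dgE mulr_ge0 ?expR_ge0//.
  by apply: mulr_ge0; lra.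
rewrite -g0; apply: (@ler0_derive1_nincr _ g x 0) => // t.
rewrite in_itv/= => /andP[xt t0]; rewrite dgE mulr_le0_ge0 ?expR_ge0//.
by apply: mulr_le0_ge0; lra.
Qed.

Lemma le_expR_tangent u c : u <= expR (u - c) + c - 1.
Proof. by have := expR_ge1Dx (u - c); lra. Qed.

Lemma expRDexpRN_le x : `|x| <= 1 -> expR x + expR (- x) <= 2 * expR (x ^+ 2).
Proof.
rewrite ler_norml => /andP[x0 x1].
have := expR_le1DxDsqr x1; have := @expR_le1DxDsqr (- x); rewrite sqrrN.
have := expR_ge1Dx (x ^+ 2).
by move=> h h1 h2; have := h1 ltac:(lra); lra.
Qed.

(** exp (1/11) >= 12/11, and three squarings, rounded down to 119/100, 283/200 and 2, give exp
    (8/11) >= 2. In the metric dimension bound this constant leaves a narrow margin: 12 (8/131 +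
    8/11 * 4/131) = 1440/1441. *)
Lemma ln2_le : ln 2 <= 8 / 11 :> R.
Proof.
have sq a b c : 0 <= a -> c <= a ^+ 2 -> a <= b -> c <= b ^+ 2.
  move=> a0 ca ab; apply: (le_trans ca).
  by rewrite lerXn2r ?nnegrE// (le_trans a0 ab).
rewrite -ler_expR lnK ?posrE//.
have -> : 8 / 11 = (1 / 11) * 8%:R :> R by lra.
rewrite expRM_natr -[8%N]/(2 * 2 * 2)%N !exprM.
apply: (sq (283 / 200)); [lra|lra|].
apply: (sq (119 / 100)); [lra|lra|].
apply: (sq (12 / 11)); [lra|lra|].
by have := expR_ge1Dx (1 / 11 : R); lra.
Qed.

(** Chernoff's argument: with q = V / m <= 1, q^V <= q^k for k <= V, so q^V times the sum is at most
    (1 + q)^m <= exp (q m) = exp V by the binomial formula. *)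
Lemma sum_bin_le (m V : nat) : (0 < V)%N -> (V <= m)%N ->
  (\sum_(k < V.+1) 'C(m, k))%:R <= (expR 1 * (m%:R / V%:R)) ^+ V :> R.
Proof.
move=> V0 Vm; have m0 : (0 < m)%N by apply: leq_trans Vm.
pose q : R := V%:R / m%:R.
have q0 : 0 < q by rewrite divr_gt0 ?ltr0n.
have q1 : q <= 1 by rewrite ler_pdivrMr ?ltr0n// mul1r ler_nat.
have qE : m%:R / V%:R = q^-1 by rewrite invf_div.
rewrite exprMn qE exprVn ler_pdivlMr ?exprn_gt0// -expRM_natr mul1r.
apply: (@le_trans _ _ ((1 + q) ^+ m)).
  rewrite exprDn natr_sum mulr_suml.
  rewrite (big_ord_widen m.+1 (fun k => 'C(m, k)%:R * q ^+ V))// big_mkcond/=.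
  apply: ler_sum => i _; rewrite expr1n mul1r -[leRHS]mulr_natl.
  case: ifP => iV; last by rewrite mulr_ge0 // exprn_ge0 // ltW.
  by rewrite ler_wpM2l// ler_wiXn2l// ltW.
have -> : V%:R = q * m%:R by rewrite /q divfK// pnatr_eq0 -lt0n.
rewrite expRM_natr lerXn2r ?nnegrE ?expR_ge0 ?expR_ge1Dx//.
by rewrite addr_ge0// ltW.
Qed.

End real_inequalities.

(** * Rademacher averages *)

Section rademacher.
Variables (R : realType) (n : nat).
Implicit Types (a : 'I_n -> R) (e : {ffun 'I_n -> bool}).

Lemma rademacher_mgf a : (forall i, `|a i| <= 1) ->
  2 ^- n * \sum_(e : {ffun 'I_n -> bool}) expR (\sum_i (-1) ^+ e i * a i) <= expR (\sum_i a i ^+ 2).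
Proof.
move=> a1.
under eq_bigr do rewrite expR_sum.
rewrite -(bigA_distr_bigA (fun i (b : bool) => expR ((-1) ^+ b * a i)))/=.
have -> : 2 ^+ n = \prod_(i < n) 2 :> R by rewrite prodr_const card_ord.
rewrite expR_sum ler_pdivrMl ?prodr_gt0//.
rewrite -big_split/=; apply: ler_prod => i _; rewrite big_bool/= expr1 expr0.
rewrite mulN1r mul1r addrC addr_ge0 ?expR_ge0//=.
exact: expRDexpRN_le.
Qed.

(* [u <= expR (u - c) + c - 1] with c = ln (2 N) + lam ^ 2 v replaces the usual
   appeal to Jensen's inequality. *)
Lemma rademacher_max (I : finType) (D : pred I) (a : I -> 'I_n -> R)
    (lam v N : R) :
  0 < lam -> 0 < N -> (\sum_(t | D t) 1)%:R <= N ->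
  (forall t i, D t -> `|lam * a t i| <= 1) ->
  (forall t, D t -> \sum_i a t i ^+ 2 <= v) ->
  exists2 H : {ffun 'I_n -> bool} -> R,
    forall e t, D t -> `|\sum_i (-1) ^+ e i * a t i| <= H e &
    2 ^- n * \sum_(e : {ffun 'I_n -> bool}) H e <= ln (2 * N) / lam + lam * v.
Proof.
move=> lam0 N0 DN a1 av.
pose c := ln (2 * N) + lam ^+ 2 * v.
pose S e t := \sum_i (-1) ^+ e i * a t i.
pose E e t := expR (lam * S e t) + expR (- (lam * S e t)).
(* There are at most 2 N exponentials, each of average at most exp (lam^2 v) over the signs; c is
   the logarithm of the product of these bounds, so the average of exp (- c) times their sum is at
   most 1. *)
exists (fun e => lam^-1 * (c - 1 + expR (- c) * \sum_(t | D t) E e t)).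
  move=> e t Dt; rewrite ler_pdivlMl// addrC.
  apply: le_trans (le_expR_tangent _ c) _; rewrite -addrA lerD2r addrC expRD.
  rewrite ler_wpM2l ?expR_ge0// (bigD1 t)//= -[leLHS]addr0 lerD//; last first.
    by apply: sumr_ge0 => t' _; rewrite addr_ge0 ?expR_ge0.
  rewrite -{1}(ger0_norm (ltW lam0)) -normrM /E /S.
  by have [h|h] := ger0P (lam * _); rewrite ?lerDl ?lerDr expR_ge0.
have mgf t : D t -> 2 ^- n * \sum_(e : {ffun 'I_n -> bool}) E e t <= 2 * expR (lam ^+ 2 * v).
  move=> Dt; rewrite big_split/= mulrDr.
  have half b : (forall i, `|b i| <= 1) -> (forall i, b i ^+ 2 = lam ^+ 2 * a t i ^+ 2) ->
      2 ^- n * \sum_(e : {ffun 'I_n -> bool}) expR (\sum_i (-1) ^+ e i * b i) <=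
      expR (lam ^+ 2 * v).
    move=> b1 bE; apply: le_trans (rademacher_mgf b1) _; rewrite ler_expR.
    under eq_bigr do rewrite bE.
    by rewrite -mulr_sumr ler_wpM2l ?sqr_ge0// av.
  rewrite [leRHS]mulr_natl mulr2n; apply: lerD.
    rewrite (eq_bigr (fun e : {ffun 'I_n -> bool} =>
      expR (\sum_i (-1) ^+ e i * (lam * a t i)))) => [|e _].
      by apply: half => i; rewrite ?a1// exprMn.
    by congr expR; rewrite mulr_sumr; apply: eq_bigr => i _; rewrite mulrCA.
  rewrite (eq_bigr (fun e : {ffun 'I_n -> bool} =>
      expR (\sum_i (-1) ^+ e i * (- (lam * a t i))))) => [|e _].
    by apply: half => i; rewrite ?normrN ?a1// sqrrN exprMn.
  congr expR; rewrite mulr_sumr -sumrN; apply: eq_bigr => i _.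
  by rewrite mulrN mulrCA.
rewrite [leLHS](_ : _ = lam^-1 * (c - 1 + expR (- c) *
    \sum_(t | D t) (2 ^- n * \sum_(e : {ffun 'I_n -> bool}) E e t))); last first.
  rewrite -[X in _ * X = _]mulr_sumr mulrCA; congr (_ * _).
  rewrite big_split/= mulrDr sumr_const card_ffun card_ord card_bool.
  rewrite -(mulr_natr (c - 1)) natrX mulrCA mulVf ?mulr1 ?expf_neq0//; congr (_ + _).
  by rewrite -[X in _ * X = _]mulr_sumr exchange_big/= mulrCA mulr_sumr.
have hsum : \sum_(t | D t) (2 ^- n * \sum_(e : {ffun 'I_n -> bool}) E e t) <= expR c.
  apply: (@le_trans _ _ (\sum_(t | D t) 2 * expR (lam ^+ 2 * v))).
    exact: ler_sum.
  rewrite /c expRD lnK ?posrE ?mulr_gt0// -mulr_suml ler_wpM2r ?expR_ge0//.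
  rewrite (eq_bigr (fun=> 2 * 1%:R)) => [|t _]; last by rewrite mulr1.
  by rewrite -mulr_sumr -natr_sum ler_wpM2l.
rewrite ler_pdivrMl//.
have : expR (- c) * \sum_(t | D t) (2 ^- n * \sum_(e : {ffun 'I_n -> bool}) E e t) <= 1.
  by rewrite expRN ler_pdivrMl ?expR_gt0// mulr1.
have -> : lam * (ln (2 * N) / lam + lam * v) = c.
  by rewrite /c mulrDr mulrCA mulfV ?gt_eqF// mulr1 mulrA expr2.
by lra.
Qed.

End rademacher.

(** * Change of variables and independence *)

Section change_of_variables.
Local Open Scope ereal_scope.
Context d (T : measurableType d) (R : realType).
Variable g : T -> \bar R.
Hypotheses (mg : measurable_fun setT g) (g0 : forall x, 0 <= g x).

Import HBNNSimple.
Let h := nnsfun_approx measurableT mg.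

Let integral_weighted_comp d1 (Y : measurableType d1)
    (nu : {measure set Y -> \bar R}) (phi : Y -> T) (W : Y -> R) :
  measurable_fun setT phi -> measurable_fun setT W -> (forall y, (0 <= W y)%R) ->
  \int[nu]_y ((W y)%:E * g (phi y)) =
  limn (fun n => \sum_(k \in range (h n))
    k%:E * \int[nu]_y ((W y)%:E * (\1_(h n @^-1` [set k]) (phi y))%:E)).
Proof.
move=> mphi mW W0.
have mhphi n : measurable_fun setT (fun y => h n (phi y)).
  by apply: measurableT_comp mphi; exact: measurable_funP.
have mind n k : measurable_fun setT
    (fun y => (\1_(h n @^-1` [set k]) (phi y) : R)).
  by apply: measurableT_comp mphi; exact: measurable_indic.
transitivity (limn (fun n => \int[nu]_y ((W y)%:E * (h n (phi y))%:E))).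
  rewrite -monotone_convergence//.
  - apply: eq_integral => y _; apply/esym/cvg_lim => //.
    by apply: cvgeZl => //; apply: cvg_nnsfun_approx => // *; exact: g0.
  - by move=> n; apply/measurable_EFinP/measurable_funM.
  - by move=> n y _; rewrite -EFinM lee_fin mulr_ge0.
  - move=> y _ m n mn; rewrite lee_wpmul2l ?lee_fin//.
    exact/lefP/nd_nnsfun_approx.
congr (limn _); apply/funext => n.
transitivity (\int[nu]_y (\sum_(k \in range (h n))
    (W y)%:E * (k%:E * (\1_(h n @^-1` [set k]) (phi y))%:E))).
  apply: eq_integral => y _; rewrite fimfunE -fsumEFin//.
  by rewrite ge0_mule_fsumr// => k; exact: nnfun_muleindic_ge0.
have F0 k y : 0 <= (W y)%:E * (k%:E * (\1_(h n @^-1` [set k]) (phi y))%:E).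
  by rewrite mule_ge0 ?lee_fin//; exact: nnfun_muleindic_ge0.
rewrite ge0_integral_fsum//; last first.
  move=> k; apply/measurable_EFinP; apply: measurable_funM => //.
  exact: measurable_funM.
apply: eq_fsbigr => k _.
have [k0|k0] := leP 0%R k; last first.
  rewrite preimage_nnfun0// !integral0_eq ?mule0// => y _;
  by rewrite indic0 ?mule0.
under eq_integral do rewrite muleCA.
rewrite ge0_integralZl_EFin//.
- by move=> y _; rewrite mule_ge0 ?lee_fin.
- by apply/measurable_EFinP; exact: measurable_funM.
Qed.

(** The weights let one statement serve three purposes: densities in [law_expectation], the
    remaining factors in [expectation_prod], and invariance under a map in [integral_swap]. *)
Lemma eq_integral_weighted_comp d1 (Y : measurableType d1)
    (nu : {measure set Y -> \bar R}) (phi : Y -> T) (W : Y -> R)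
    d2 (Z : measurableType d2)
    (nu' : {measure set Z -> \bar R}) (phi' : Z -> T) (W' : Z -> R) :
  measurable_fun setT phi -> measurable_fun setT W -> (forall y, (0 <= W y)%R) ->
  measurable_fun setT phi' -> measurable_fun setT W' ->
  (forall z, (0 <= W' z)%R) ->
  (forall A, measurable A -> \int[nu]_y ((W y)%:E * (\1_A (phi y))%:E)
    = \int[nu']_z ((W' z)%:E * (\1_A (phi' z))%:E)) ->
  \int[nu]_y ((W y)%:E * g (phi y)) = \int[nu']_z ((W' z)%:E * g (phi' z)).
Proof.
move=> mphi mW W0 mphi' mW' W'0 H.
rewrite !integral_weighted_comp//; congr (limn _); apply/funext => n.
by apply: eq_fsbigr => k _; rewrite H.
Qed.

End change_of_variables.

Lemma integral_cst_probability d (T : measurableType d) (R : realType)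
    (P : probability T R) (c : R) : (\int[P]_x c%:E = c%:E)%E.
Proof.
rewrite integral_cst// -[RHS]mule1; congr (_ * _)%E.
exact: probability_setT.
Qed.

Section independence.
Variables (R : realType) (n : nat) (d : 'I_n -> measure_display).
Variable X : forall i, measurableType (d i).
Variable P : probability (sampleType X) R.

Lemma measurable_coord i : measurable_fun setT (fun x : sampleType X => x i).
Proof.
move=> _ A mA; rewrite setTI; apply: sub_sigma_algebra.
by exists i, A.
Qed.

Lemma measurable_rectangle (A : forall i, set (X i)) :
  (forall i, measurable (A i)) ->
  measurable [set x : sampleType X | forall i, A i (x i)].
Proof.
move=> mA.
have -> : [set x : sampleType X | forall i, A i (x i)] =
    \bigcap_(i in setT) [set x : sampleType X | A i (x i)].
  by apply/seteqP; split => x /= H i *; exact: H.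
apply: fin_bigcap_measurable => // i _.
by rewrite -[X in measurable X]setTI; exact: measurable_coord.
Qed.

Hypothesis P_rect : forall A : (forall i, set (X i)),
  (forall i, measurable (A i)) ->
  P [set x : sampleType X | forall i, A i (x i)] =
  (\prod_(i < n) P [set x : sampleType X | A i (x i)])%E.

(* The factors [g i] are general for i < k and indicators for k <= i; each step
   turns one indicator into a general function by [eq_integral_weighted_comp]. *)
Lemma expectation_prod (f : forall i, X i -> R) (B : R) :
  (forall i, measurable_fun setT (f i)) -> (forall i x, 0 <= f i x <= B) ->
  (\int[P]_x (\prod_(i < n) f i (x i))%:E =
   \prod_(i < n) \int[P]_x (f i (x i))%:E)%E.
Proof.
move=> mf fB.
(* The bound is [Num.max B 1] because an indicator put in place of a factor must satisfy it too; it
   keeps the expectations finite. *)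
suff main k (g : forall i, X i -> R) : (k <= n)%N ->
    (forall i, measurable_fun setT (g i)) ->
    (forall i x, 0 <= g i x <= Num.max B 1) ->
    (forall i : 'I_n, (k <= i)%N -> exists2 A, measurable A & g i = \1_A) ->
    (\int[P]_x (\prod_(i < n) g i (x i))%:E =
     \prod_(i < n) \int[P]_x (g i (x i))%:E)%E.
  apply: (main n) => // [i x|i]; last by rewrite leqNgt ltn_ord.
  by have /andP[-> fB'] := fB i x; rewrite le_max fB'.
elim: k g => [|k IH] g kn mg g0 gA.
  have {gA}gA i := gA i (leq0n i).
  pose A i := s2val (cid2 (gA i)).
  have mA i : measurable (A i) by rewrite /A; case: cid2.
  have gE i : g i = \1_(A i) by rewrite /A; case: cid2.
  have mA' i : measurable [set x : sampleType X | A i (x i)].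
    by rewrite -[X in measurable X]setTI; exact: measurable_coord.
  transitivity (P [set x | forall i, A i (x i)]).
    rewrite -[X in P X]setIT -integral_indic//; last exact: measurable_rectangle.
    apply: eq_integral => x _; congr EFin; rewrite indicE.
    have [/set_mem Ax|/negP nAx] := boolP (x \in _).
      by rewrite big1// => i _; rewrite gE indicE mem_set//; exact: Ax.
    apply/eqP/prodf_eq0; apply: contrapT => H; apply: nAx; apply/mem_set => i.
    apply: contrapT => Ai; apply: H; exists i => //.
    by rewrite gE indicE memNset.
  rewrite P_rect//; apply: eq_bigr => i _.
  rewrite -[X in P X]setIT -integral_indic//.
  by apply: eq_integral => x _; rewrite gE !indicE.
pose j := Ordinal kn.
have mcomp (h : forall i, X i -> R) i : measurable_fun setT (h i) ->
    measurable_fun setT (fun x : sampleType X => h i (x i)).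
  move=> mh; have h1 := measurableT_comp mh (measurable_coord (i:=i)); exact: h1.
pose c := (\prod_(i < n | i != j) \int[P]_x (g i (x i))%:E)%E.
have c0 : (0 <= c)%E.
  apply: prode_ge0 => i _; apply: integral_ge0 => x _; rewrite lee_fin.
  by case/andP: (g0 i (x i)).
have cfin : c \is a fin_num.
  apply: prode_fin_num => i _; rewrite ge0_fin_numE; last first.
    by apply: integral_ge0 => x _; rewrite lee_fin; case/andP: (g0 i (x i)).
  apply: (@le_lt_trans _ _ (\int[P]_x (Num.max B 1)%:E)%E).
    apply: ge0_le_integral => //.
    - by move=> x _; rewrite lee_fin; case/andP: (g0 i (x i)).
    - by apply/measurable_EFinP; exact: mcomp.
    - by move=> x _; rewrite lee_fin; case/andP: (g0 i (x i)).
  by rewrite integral_cst_probability ltry.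
pose W (x : sampleType X) := \prod_(i < n | i != j) g i (x i).
have mW : measurable_fun setT W.
  rewrite (_ : W = fun x : sampleType X =>
      \prod_(i <- [seq i <- index_enum 'I_n | i != j]) g i (x i)).
    by apply: measurable_prod => i _; exact: mcomp.
  by apply/funext => x; rewrite big_filter.
have W0 x : 0 <= W x.
  by apply: prodr_ge0 => i _; case/andP: (g0 i (x i)).
transitivity (\int[P]_x ((W x)%:E * (g j (x j))%:E))%E.
  by apply: eq_integral => x _; rewrite (bigD1 j)//= EFinM muleC.
transitivity (\int[P]_x ((fine c)%:E * (g j (x j))%:E))%E; last first.
  rewrite ge0_integralZl_EFin ?fine_ge0//.
  - by rewrite fineK// [RHS](bigD1 j)//= muleC.
  - by move=> x _; rewrite lee_fin; case/andP: (g0 j (x j)).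
  - by apply/measurable_EFinP; exact: mcomp.
(* The two weights are the product of the other factors and the product of their means; on
   indicators of subsets of [X j], the required equality is the induction hypothesis for [g']. *)
apply: (@eq_integral_weighted_comp _ _ _ (EFin \o g j) _ _ _ _ _
    (fun x : sampleType X => x j) W _ _ _ (fun x : sampleType X => x j)
    (fun=> fine c)) => //.
- by apply/measurable_EFinP.
- by move=> x; rewrite lee_fin; case/andP: (g0 j x).
- exact: measurable_coord.
- exact: measurable_coord.
- by move=> _; exact: fine_ge0.
move=> A mA; pose g' := dfwith g j (\1_A : X j -> R).
have g'j : g' j = \1_A by rewrite /g' dfwithin.
have g'N i : i != j -> g' i = g i by move=> ij; rewrite /g' dfwithout// eq_sym.
transitivity (\int[P]_x (\prod_(i < n) g' i (x i))%:E)%E.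
  apply: eq_integral => x _; rewrite (bigD1 j)//= g'j EFinM muleC; congr (_ * _%:E)%E.
  by apply: eq_bigr => i ij; rewrite g'N.
rewrite IH ?(ltnW kn)//; last 3 first.
- move=> i; have [->|ij] := eqVneq i j; last by rewrite g'N.
  by rewrite g'j; exact: measurable_indic.
- move=> i x; have [ij|ij] := eqVneq i j; last by rewrite g'N.
  move: x; rewrite ij g'j => x; rewrite indicE le_max.
  by case: (x \in A); rewrite /= ?lexx ?ler01 ?orbT.
- move=> i; rewrite leq_eqVlt => /predU1P[ki|ki].
    have -> : i = j by apply: val_inj.
    by exists A.
  rewrite g'N; first exact: gA.
  by apply: contraTneq ki => ->; rewrite ltnn.
rewrite (bigD1 j)//= g'j muleC ge0_integralZl_EFin ?fine_ge0//.
- by rewrite fineK// /c; congr (_ * _)%E; apply: eq_bigr => i ij; rewrite g'N.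
- apply/measurable_EFinP; have := mcomp g' j; rewrite g'j; apply.
  exact: measurable_indic.
Qed.

End independence.

(** * The function psi and the Hellinger distance *)

Section psi_ratio_real.
Variable R : realType.
Implicit Types a b s : R.

(* At [a = b = 0] both sides vanish: [psi 1 = 0], and Rocq's [0 / 0] is [0]. *)
Lemma psi_edivE a b : 0 <= a -> 0 <= b ->
  psi (sqrte (ediv a b)) = (Num.sqrt a - Num.sqrt b) / Num.sqrt (a + b).
Proof.
move=> a0 b0; rewrite /ediv; have [->|bN0] := eqVneq b 0.
  have [->|aN0] := eqVneq a 0.
    by rewrite /= sqrtr1 subrr mul0r sqrtr0 subrr mul0r.
  rewrite /= sqrtr0 subr0 addr0 divff// sqrtr_eq0 -ltNge.
  by rewrite lt_neqAle eq_sym aN0.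
have b1 : 0 < b by rewrite lt_neqAle eq_sym bN0.
have sb : 0 < Num.sqrt b by rewrite sqrtr_gt0.
rewrite /= sqr_sqrtr ?divr_ge0// sqrtrM// sqrtrV//.
have -> : 1 + a / b = (a + b) / b by rewrite mulrDl divff// addrC.
rewrite sqrtrM ?addr_ge0// sqrtrV//.
have : Num.sqrt (a + b) != 0 by rewrite gt_eqF// sqrtr_gt0; lra.
by move: (gt_eqF sb) => /negbT sb0 sab0; field; rewrite sb0 sab0.
Qed.

Lemma psi_ediv_norm_le1 a b : 0 <= a -> 0 <= b -> `|psi (sqrte (ediv a b))| <= 1.
Proof.
move=> a0 b0; rewrite psi_edivE// normrM normfV [X in _ / X]ger0_norm ?sqrtr_ge0//.
have [->|] := eqVneq (Num.sqrt (a + b)) 0; first by rewrite invr0 mulr0.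
rewrite sqrtr_eq0 -ltNge => ab.
rewrite ler_pdivrMr ?sqrtr_gt0// mul1r -sqrtr_sqr ler_sqrt ?(ltW ab)//.
rewrite sqrrB !sqr_sqrtr//.
by have := mulr_ge0 (sqrtr_ge0 a) (sqrtr_ge0 b); lra.
Qed.

(** With p, p', q the square roots of a, a', b, clearing denominators and squaring leaves the
    difference 2 q (p' - p) (p p' - q^2). It is nonnegative if q <= p and nonpositive if p' < q,
    where squaring reverses the order; for p < q <= p' the two sides are separated by 0. *)
Lemma psi_ediv_mono a a' b : 0 <= a -> 0 <= b -> a <= a' ->
  psi (sqrte (ediv a b)) <= psi (sqrte (ediv a' b)).
Proof.
move=> a0 b0 aa'; have a'0 := le_trans a0 aa'.
rewrite !psi_edivE//.
have [ab0|ab0] := eqVneq (a + b) 0.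
  have [-> ->] : a = 0 /\ b = 0 by split; lra.
  by rewrite addr0 subrr mul0r sqrtr0 subr0 divr_ge0 ?sqrtr_ge0.
have ab : 0 < a + b by rewrite lt_neqAle eq_sym ab0 addr_ge0.
have a'b : 0 < a' + b by lra.
rewrite ler_pdivrMr ?sqrtr_gt0// mulrAC ler_pdivlMr ?sqrtr_gt0//.
set p := Num.sqrt a; set q := Num.sqrt b; set p' := Num.sqrt a'.
have p0 : 0 <= p := sqrtr_ge0 _.
have q0 : 0 <= q := sqrtr_ge0 _.
have p'0 : 0 <= p' := sqrtr_ge0 _.
have pp' : p <= p' by rewrite ler_sqrt.
have aE : a = p ^+ 2 by rewrite sqr_sqrtr.
have bE : b = q ^+ 2 by rewrite sqr_sqrtr.
have a'E : a' = p' ^+ 2 by rewrite sqr_sqrtr.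
have sq x y c d : 0 <= x -> 0 <= y -> 0 < c -> 0 < d ->
    x ^+ 2 * c <= y ^+ 2 * d -> x * Num.sqrt c <= y * Num.sqrt d.
  move=> x0 y0 c0 d0 h.
  rewrite -[x * _]ger0_norm ?mulr_ge0 ?sqrtr_ge0// -[y * _]ger0_norm ?mulr_ge0 ?sqrtr_ge0//.
  by rewrite -!sqrtr_sqr ler_sqrt ?sqr_ge0// !exprMn !sqr_sqrtr ?(ltW c0) ?(ltW d0).
have [qp|pq] := leP q p.
  apply: sq => //; [lra|lra|rewrite aE a'E bE].
  have : 0 <= 2 * q * ((p' - p) * (p * p' - q ^+ 2)).
    rewrite !mulr_ge0// ?subr_ge0// expr2 ler_pM//.
    exact: le_trans pp'.
  by lra.
have [qp'|p'q] := leP q p'.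
  apply: (@le_trans _ _ 0); rewrite ?mulr_ge0 ?sqrtr_ge0 ?subr_ge0//.
  by rewrite mulr_le0_ge0 ?sqrtr_ge0// subr_le0 ltW.
rewrite -lerN2 -!mulNr !opprB; apply: sq => //; [lra|lra|rewrite aE a'E bE].
have : 0 <= 2 * q * ((p' - p) * (q ^+ 2 - p * p')).
  rewrite !mulr_ge0// ?subr_ge0// expr2 ler_pM//; exact: ltW.
by lra.
Qed.

(* With d = sqrt a - sqrt b and m the midpoint of sqrt a and sqrt b:
   d ^ 2 <= a + b, m ^ 2 <= (a + b) / 2 and
   s <= 3 / 2 * m ^ 2 + 3 * (sqrt s - m) ^ 2. *)
Lemma psi_ediv_sqr_le s a b : 0 <= s -> 0 <= a -> 0 <= b ->
  s * psi (sqrte (ediv a b)) ^+ 2 <=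
  3 / 2 * ((Num.sqrt s - Num.sqrt a) ^+ 2 + (Num.sqrt s - Num.sqrt b) ^+ 2).
Proof.
move=> s0 a0 b0; rewrite psi_edivE// exprMn exprVn sqr_sqrtr ?addr_ge0//.
set x := Num.sqrt s; set p := Num.sqrt a; set q := Num.sqrt b.
have p0 : 0 <= p := sqrtr_ge0 _.
have q0 : 0 <= q := sqrtr_ge0 _.
have sE : s = x ^+ 2 by rewrite sqr_sqrtr.
have abE : a + b = p ^+ 2 + q ^+ 2 by rewrite !sqr_sqrtr.
have rhs0 : 0 <= 3 / 2 * ((x - p) ^+ 2 + (x - q) ^+ 2).
  by rewrite mulr_ge0 ?addr_ge0 ?sqr_ge0//; lra.
have [ab0|ab0] := eqVneq (a + b) 0; first by rewrite ab0 invr0 !mulr0.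
have ab : 0 < a + b by rewrite lt_neqAle eq_sym ab0 addr_ge0.
rewrite mulrA ler_pdivrMr// sE abE.
pose d := p - q; pose m := (p + q) / 2.
have -> : p - q = d by [].
have -> : (x - p) ^+ 2 + (x - q) ^+ 2 = 2 * (x - m) ^+ 2 + d ^+ 2 / 2.
  by rewrite /m /d; field.
have dw : d ^+ 2 <= p ^+ 2 + q ^+ 2.
  by rewrite /d; have := mulr_ge0 p0 q0; rewrite sqrrB; lra.
have mw : m ^+ 2 <= (p ^+ 2 + q ^+ 2) / 2.
  by rewrite /m; have := sqr_ge0 (p - q); rewrite sqrrB; lra.
have xm : x ^+ 2 <= 3 / 2 * m ^+ 2 + 3 * (x - m) ^+ 2.
  by have := sqr_ge0 (2 * x - 3 * m); lra.
have := ler_wpM2r (sqr_ge0 d) xm.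
have := ler_wpM2r (sqr_ge0 d) mw.
have := ler_wpM2l (sqr_ge0 (x - m)) dw.
set w := p ^+ 2 + q ^+ 2; lra.
Qed.

End psi_ratio_real.

Lemma measurable_sqrt (R : realType) : measurable_fun setT (@Num.sqrt R).
Proof. by apply: continuous_measurable_fun; exact: sqrt_continuous. Qed.

Section density_process.
Variables (R : realType) (n : nat) (d : 'I_n -> measure_display).
Variable X : forall i, measurableType (d i).
Variable mu : forall i, {measure set (X i) -> \bar R}.
Implicit Types s t : dens R X.

Definition psi_comp t t' i (y : X i) : R := psi (sqrte (ediv (t' i y) (t i y))).

Lemma psi_comp_norm_le1 t t' i y : L0 mu t -> L0 mu t' ->
  `|psi_comp t t' (i := i) y| <= 1.
Proof.
by move=> /(_ i)[_ t0 _] /(_ i)[_ t'0 _]; exact: psi_ediv_norm_le1.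
Qed.

Lemma measurable_psi_comp t t' i : L0 mu t -> L0 mu t' ->
  measurable_fun setT (psi_comp t t' (i := i)).
Proof.
move=> /(_ i)[mt t0 _] /(_ i)[mt' t'0 _].
rewrite (_ : psi_comp t t' (i := i) = fun y =>
    (Num.sqrt (t' i y) - Num.sqrt (t i y)) * (t' i y + t i y) `^ (- 2^-1)).
  apply: measurable_funM.
    by apply: measurable_funB; apply: measurableT_comp => //; exact: measurable_sqrt.
  apply: (measurableT_comp (@measurable_powR R (- 2^-1))).
  exact: measurable_funD.
apply/funext => y; rewrite /psi_comp psi_edivE//.
by rewrite powRN powR12_sqrt// addr_ge0.
Qed.

Let msqrtB s t i : L0 mu s -> L0 mu t ->
  measurable_fun setT (fun y => (Num.sqrt (s i y) - Num.sqrt (t i y)) ^+ 2).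
Proof.
move=> /(_ i)[ms _ _] /(_ i)[mt _ _]; apply: measurable_funX.
by apply: measurable_funB; apply: measurableT_comp => //; exact: measurable_sqrt.
Qed.

(** [hsq1] uses a real-valued integral, which would read +oo as 0. The integrand is at most s + t,
    whose integral is 2, so nothing is lost. *)
Lemma hsq1E s t i : L0 mu s -> L0 mu t ->
  (\int[mu i]_y ((Num.sqrt (s i y) - Num.sqrt (t i y)) ^+ 2)%:E =
   (2 * hsq1 mu (s i) (t i))%:E)%E.
Proof.
move=> Ls Lt; rewrite /hsq1 mulrA divff// mul1r /Rintegral fineK//.
rewrite ge0_fin_numE; last by apply: integral_ge0 => y _; rewrite lee_fin sqr_ge0.
have [ms s0 s1] := Ls i; have [mt t0 t1] := Lt i.
apply: (@le_lt_trans _ _ (\int[mu i]_y ((s i y)%:E + (t i y)%:E))%E).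
  apply: ge0_le_integral => //.
  - by move=> y _; rewrite lee_fin sqr_ge0.
  - by apply/measurable_EFinP; exact: msqrtB.
  - by apply/measurable_EFinP; exact: measurable_funD.
  - move=> y _; rewrite -EFinD lee_fin sqrrB !sqr_sqrtr//.
    by have := mulr_ge0 (sqrtr_ge0 (s i y)) (sqrtr_ge0 (t i y)); lra.
rewrite ge0_integralD//; try by apply/measurable_EFinP.
- by rewrite s1 t1 -EFinD ltry.
- by move=> y _; rewrite lee_fin.
- by move=> y _; rewrite lee_fin.
Qed.

Lemma hsq1_ge0 s t i : 0 <= hsq1 mu (s i) (t i).
Proof.
rewrite /hsq1 mulr_ge0// /Rintegral fine_ge0//.
by apply: integral_ge0 => y _; rewrite lee_fin sqr_ge0.
Qed.

Lemma hsq_ge0 s t : 0 <= hsq mu s t.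
Proof. by apply: sumr_ge0 => i _; exact: hsq1_ge0. Qed.

Lemma hsqxx t : hsq mu t t = 0.
Proof.
rewrite /hsq big1// => i _; rewrite /hsq1 /Rintegral.
under eq_integral do rewrite subrr expr0n.
by rewrite integral0 mulr0.
Qed.

Lemma hdistxx t : hdist mu t t = 0.
Proof. by rewrite /hdist hsqxx sqrtr0. Qed.

Lemma hdist_ge0 s t : 0 <= hdist mu s t.
Proof. exact: sqrtr_ge0. Qed.

Lemma hdist_le s t y : 0 <= y -> hsq mu s t <= y ^+ 2 -> hdist mu s t <= y.
Proof.
move=> y0 h; rewrite /hdist -(ger0_norm y0) -sqrtr_sqr ler_sqrt//.
exact: sqr_ge0.
Qed.

(** Distance zero makes u and v have the same square root almost everywhere only. As elements of
    [L0] are functions, this congruence takes the place of equality when representatives are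
    chosen. *)
Lemma hsq_eq0_congr t u v : L0 mu t -> L0 mu u -> L0 mu v -> hsq mu u v = 0 ->
  hsq mu t u = hsq mu t v.
Proof.
move=> Lt Lu Lv uv0; apply: eq_bigr => i _; congr (_ * _).
rewrite /Rintegral; congr fine.
have uv : hsq1 mu (u i) (v i) = 0.
  apply/eqP; rewrite eq_le hsq1_ge0 andbT -uv0 /hsq (bigD1 i)//= lerDl.
  by apply: sumr_ge0 => j _; exact: hsq1_ge0.
apply: ae_eq_integral => //.
- by apply/measurable_EFinP; exact: msqrtB.
- by apply/measurable_EFinP; exact: msqrtB.
have : ae_eq (mu i) setT
    (fun y => ((Num.sqrt (u i y) - Num.sqrt (v i y)) ^+ 2)%:E) (cst 0%E).
  apply/ae_eq_integral_abs => //; first by apply/measurable_EFinP; exact: msqrtB.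
  under eq_integral do rewrite gee0_abs ?lee_fin ?sqr_ge0//.
  by rewrite hsq1E// uv mulr0.
apply: filterS => y /= /(_ Logic.I)/eqP; rewrite eqe sqrf_eq0 subr_eq0 => /eqP uvy _.
by rewrite uvy.
Qed.

Section law.
Variables (s : dens R X) (P : probability (sampleType X) R).
Arguments s : clear implicits.
Hypotheses (Ls : L0 mu s) (lawP : is_law mu s P).

Lemma law_marginal i A : measurable A ->
  (P [set x : sampleType X | A (x i)] = \int[mu i]_(x in A) (s i x)%:E)%E.
Proof.
move=> mA; pose A' := dfwith (fun j => [set: X j]) i A.
have A'i : A' i = A by rewrite /A' dfwithin.
have A'N j : j != i -> A' j = setT by move=> ij; rewrite /A' dfwithout// eq_sym.
have mA' j : measurable (A' j).
  by have [->|ji] := eqVneq j i; rewrite ?A'i// A'N.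
have -> : [set x : prodX X | A (x i)] = [set x | forall j, A' j (x j)].
  apply/seteqP; split => x /= => [Ax j|/(_ i)]; last by rewrite A'i.
  by have [->|ji] := eqVneq j i; rewrite ?A'i// A'N.
rewrite lawP// (bigD1 i)//= A'i big1 ?mule1// => j ji; rewrite A'N//.
by have [_ _] := Ls j.
Qed.

Lemma law_rectangle (A : forall i, set (X i)) : (forall i, measurable (A i)) ->
  (P [set x : sampleType X | forall i, A i (x i)] =
   \prod_(i < n) P [set x : sampleType X | A i (x i)])%E.
Proof.
by move=> mA; rewrite lawP//; apply: eq_bigr => i _; rewrite law_marginal.
Qed.

Lemma law_expectation i (g : X i -> R) : measurable_fun setT g ->
  (forall y, 0 <= g y) ->
  (\int[P]_x (g (x i))%:E = \int[mu i]_y (s i y * g y)%:E)%E.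
Proof.
move=> mg g0; have [ms s0 _] := Ls i.
transitivity (\int[P]_x (1%:E * (g (x i))%:E))%E.
  by under [RHS]eq_integral do rewrite mul1e.
transitivity (\int[mu i]_y ((s i y)%:E * (g y)%:E))%E; last by [].
apply: (@eq_integral_weighted_comp _ _ _ (EFin \o g) _ _ _ _ _
    (fun x : sampleType X => x i) (fun=> 1) _ _ _ (@id (X i)) (s i)) => //.
- exact/measurable_EFinP.
- exact: measurable_coord.
move=> A mA; have mA' : measurable [set x : sampleType X | A (x i)].
  by rewrite -[X in measurable X]setTI; exact: measurable_coord.
transitivity (P [set x : sampleType X | A (x i)]).
  rewrite -[X in P X]setIT -integral_indic//.
  by apply: eq_integral => x _; rewrite mul1e !indicE.
rewrite law_marginal// integral_mkcond epatch_indic.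
by apply: eq_integral.
Qed.

Lemma integral_psi_comp_sqr_le t t' i : L0 mu t -> L0 mu t' ->
  (\int[P]_x (psi_comp t t' (x i) ^+ 2)%:E <=
   (3 * (hsq1 mu (s i) (t i) + hsq1 mu (s i) (t' i)))%:E)%E.
Proof.
move=> Lt Lt'; have [ms s0 _] := Ls i.
have mpsi2 : measurable_fun setT (fun y => psi_comp t t' (i := i) y ^+ 2).
  by apply: measurable_funX; exact: measurable_psi_comp.
rewrite (law_expectation (g := fun y => psi_comp t t' (i := i) y ^+ 2))//; last first.
  by move=> y; rewrite sqr_ge0.
have [mt t0 _] := Lt i; have [mt' t'0 _] := Lt' i.
apply: (@le_trans _ _ (\int[mu i]_y ((3 / 2)%:E *
  (((Num.sqrt (s i y) - Num.sqrt (t i y)) ^+ 2)%:E +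
   ((Num.sqrt (s i y) - Num.sqrt (t' i y)) ^+ 2)%:E)))%E).
  apply: ge0_le_integral => //.
  - by move=> y _; rewrite lee_fin mulr_ge0 ?sqr_ge0.
  - by apply/measurable_EFinP; exact: measurable_funM.
  - apply: emeasurable_funM => //; apply: emeasurable_funD;
    apply/measurable_EFinP; exact: msqrtB.
  - move=> y _; rewrite -EFinD -EFinM lee_fin [X in 3 / 2 * X]addrC.
    exact: psi_ediv_sqr_le.
rewrite ge0_integralZl_EFin//; last 2 first.
- by move=> y _; rewrite -EFinD lee_fin addr_ge0 ?sqr_ge0.
- by apply: emeasurable_funD; apply/measurable_EFinP; exact: msqrtB.
rewrite ge0_integralD//; try by [move=> y _; rewrite lee_fin sqr_ge0
  | apply/measurable_EFinP; exact: msqrtB].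
by rewrite !hsq1E// -EFinD -EFinM lee_fin; lra.
Qed.

End law.
End density_process.

(** * Identifiable subsets and the dimension of a model *)

Section esup_theory.
Local Open Scope ereal_scope.
Variable R : realType.
Implicit Types (A B : set (\bar R)) (x y : \bar R).

Lemma esup_ub A x : A x -> x <= esup A.
Proof.
move=> Ax; rewrite /esup ifF; first exact: ereal_sup_ubound.
by apply/negbTE/eqP => A0; move: Ax; rewrite A0.
Qed.

Lemma esup_le A y : 0 <= y -> (forall x, A x -> x <= y) -> esup A <= y.
Proof.
by move=> y0 Ay; rewrite /esup; case: ifPn => // _; exact: ge_ereal_sup.
Qed.

Lemma esup_ge0 A : (forall x, A x -> 0 <= x) -> 0 <= esup A.
Proof.
move=> A0; rewrite /esup; case: ifPn => // /set0P[x Ax].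
by apply: (le_trans (A0 _ Ax)); exact: ereal_sup_ubound.
Qed.

Lemma measurable_esup d (T : measurableType d) (I : Type) (A : set I)
    (F : I -> T -> \bar R) :
  countable A -> (forall t, A t -> measurable_fun setT (F t)) ->
  measurable_fun setT (fun z => esup [set F t z | t in A]).
Proof.
move=> cA mF; have [A0|/set0P[t0 At0]] := eqVneq A set0.
  rewrite (_ : (fun z => _) = cst 0); first exact: measurable_cst.
  by apply/funext => x; rewrite /esup A0 image_set0 eqxx.
have /pfcard_geP[A0|[f]] := cA; first by move: At0; rewrite A0.
have Af k : A (f k) by apply: funS.
have : measurable_fun setT (fun z => esups (fun k => F (f k) z) 0%N).
  by apply: measurable_fun_esups => k; exact: mF.
apply: eq_measurable_fun => z _; rewrite /esups/= /esup ifF; last first.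
  by apply/negbTE/set0P; exists (F t0 z), t0.
congr ereal_sup; apply/seteqP; split => [_ [k _ <-]|_ [t At <-]].
  by exists (f k).
have [k _ <-] := @surj _ _ _ _ f t At.
by exists k.
Qed.

End esup_theory.

Section identifiable_subset.
Variables (R : realType) (n : nat) (d : 'I_n -> measure_display).
Variable X : forall i, measurableType (d i).
Variable mu : forall i, {measure set (X i) -> \bar R}.
Implicit Types s t u v : dens R X.

Lemma hsqC u v : hsq mu u v = hsq mu v u.
Proof.
apply: eq_bigr => i _; rewrite /hsq1; congr (_ * _).
by apply: eq_Rintegral => x _; rewrite -sqrrN opprB.
Qed.

Lemma hset_ge0 t S : (0 <= hset mu t S)%E.
Proof. by apply: le_ereal_inf_tmp => _ [u _ <-]; rewrite lee_fin hdist_ge0. Qed.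

Lemma exists_identifiable_subset (N : set (dens R X)) :
  N `<=` L0 mu -> countable N ->
  exists S, [/\ S `<=` N, countable_identifiable mu S &
    forall t, L0 mu t -> hset mu t S = hset mu t N].
Proof.
move=> NL cN; pose cls u := [set v | N v /\ hsq mu u v = 0].
(* The choice is made from the set [cls u] itself, so two elements at distance zero, having the same
   class, get the same representative. The default is not reached for u in N, which belongs to its
   own class. *)
pose rep u : dens R X := xget (fun i => cst 0) (cls u).
have repP u : N u -> cls u (rep u).
  by move=> Nu; apply: (@xgetPex _ (fun i => cst 0) (cls u)); exists u; rewrite /cls/= hsqxx.
have cls_eq u v : N u -> N v -> hsq mu u v = 0 -> cls u = cls v.
  move=> Nu Nv uv0; apply/seteqP; split => w [Nw uw0]; split => //.
    by rewrite hsqC -(hsq_eq0_congr (NL _ Nw) (NL _ Nu) (NL _ Nv) uv0) hsqC.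
  by rewrite hsqC (hsq_eq0_congr (NL _ Nw) (NL _ Nu) (NL _ Nv) uv0) hsqC.
exists [set rep u | u in N]; split.
- by move=> _ [u Nu <-]; case: (repP u Nu).
- split.
  + by move=> _ [u Nu <-]; case: (repP u Nu) => /NL.
  + by apply: sub_countable cN; exact: card_image_le.
  + move=> _ _ [u Nu <-] [v Nv <-] uv; rewrite sqrtr_gt0 lt_neqAle hsq_ge0 andbT.
    apply: contra_notN uv => /eqP/esym uv0.
    have [Nu' uu'] := repP u Nu; have [Nv' vv'] := repP v Nv.
    rewrite {1}/rep (cls_eq _ _ Nu Nu' uu') (cls_eq _ _ Nu' Nv' uv0).
    by rewrite -(cls_eq _ _ Nv Nv' vv').
move=> t Lt; congr ereal_inf; apply/seteqP; split => [_ [_ [u Nu <-] <-]|_ [u Nu <-]].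
  by exists (rep u) => //; case: (repP u Nu).
have [Nu' uu'] := repP u Nu.
exists (rep u); first by exists u.
by rewrite /hdist -(hsq_eq0_congr Lt (NL _ Nu) (NL _ Nu') uu').
Qed.

Variable P : dens R X -> probability (sampleType X) R.

Lemma c1_ge0 : 0 <= c1 R.
Proof. by rewrite /c1 mulr_ge0// addr_ge0// mulr_ge0// sqrtr_ge0. Qed.

Lemma c2_gt0 : 0 < c2 R.
Proof. by rewrite /c2 addrC ltr_wpDl// invr_ge0 sqrtr_ge0. Qed.

(** Radii with y^2 <= b cannot bring [ybar] above sqrt b, so only the larger ones have to be
    controlled; b >= 1 absorbs the maximum with 1 in [DS2]. *)
Lemma DS_le S (b : R) : 1 <= b ->
  (forall s sb y, L0 mu s -> S sb -> 0 <= y -> b < y ^+ 2 ->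
     (wS mu P S s sb y <= (c0 R * y ^+ 2)%:E)%E) ->
  (DS mu P S <= b%:E)%E.
Proof.
move=> b1 wb; have b0 : 0 <= b by exact: le_trans b1.
apply: esup_le; rewrite ?lee_fin// => _ [s Ls [sb Ssb <-]].
rewrite /DS2 ge_max; apply/andP; split; last by rewrite lee_fin.
have yb : (ybar mu P S s sb <= (Num.sqrt b)%:E)%E.
  apply: esup_le; rewrite ?lee_fin ?sqrtr_ge0// => _ [y [y0 wy] <-].
  rewrite lee_fin leNgt; apply/negP => by_.
  move: wy; rewrite ltNge => /negP; apply; apply: wb => //.
  by rewrite -(sqr_sqrtr b0) ltrXn2r ?nnegrE ?sqrtr_ge0.
have yb0 : (0 <= ybar mu P S s sb)%E.
  by apply: esup_ge0 => _ [y [y0 _] <-]; rewrite lee_fin.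
rewrite -[b](sqr_sqrtr b0) EFin_expe !expe2.
by apply: lee_pmul.
Qed.

Lemma Dmodel_le Sb S (e b : R) : countable_identifiable mu S -> 0 <= e ->
  (forall t, Sb t -> (hset mu t S <= e%:E)%E) -> (DS mu P S <= b%:E)%E ->
  (Dmodel mu P Sb <= (2 * c1 R * e ^+ 2 + c2 R * b)%:E)%E.
Proof.
move=> iS e0 he hb; apply: (@le_trans _ _
  ((2 * c1 R)%:E * esup [set (hset mu u S ^+ 2)%E | u in Sb] + (c2 R)%:E * DS mu P S)%E).
  by apply: ereal_inf_lbound; exists S.
rewrite [leRHS](_ : _ = (2 * c1 R)%:E * (e ^+ 2)%:E + (c2 R)%:E * b%:E)%E//.
apply: leeD.
  apply: lee_wpmul2l; first by rewrite lee_fin mulr_ge0// c1_ge0.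
  apply: esup_le; first by rewrite lee_fin sqr_ge0.
  move=> _ [t St <-]; rewrite EFin_expe !expe2.
  by apply: lee_pmul; rewrite ?hset_ge0// he.
by apply: lee_wpmul2l => //; rewrite lee_fin ltW// c2_gt0.
Qed.

End identifiable_subset.

(** * Exponential inequalities *)

Section bounded_expectation.
Context d (T : measurableType d) (R : realType).
Variable P : probability T R.
Implicit Types f g : T -> R.

Lemma integrable_bounded f (B : R) : measurable_fun setT f ->
  (forall x, `|f x| <= B) -> P.-integrable setT (EFin \o f).
Proof.
move=> mf fB; apply/integrableP; split; first exact/measurable_EFinP.
apply: (@le_lt_trans _ _ (\int[P]_x B%:E)%E); last first.
  by rewrite integral_cst_probability ltry.
apply: ge0_le_integral => //.
- by apply: measurableT_comp => //; exact/measurable_EFinP.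
- by move=> x _; rewrite lee_fin.
Qed.

Lemma EFin_Rintegral f : P.-integrable setT (EFin \o f) ->
  (\int[P]_x f x)%:E = (\int[P]_x (f x)%:E)%E.
Proof. by move=> fi; rewrite /Rintegral fineK//; exact: integrable_fin_num. Qed.

Lemma Rintegral_cst_probability (c : R) : \int[P]_x c = c.
Proof. by rewrite /Rintegral integral_cst_probability. Qed.

Lemma normr_Rintegral_le f (B : R) : measurable_fun setT f ->
  (forall x, `|f x| <= B) -> `|\int[P]_x f x| <= B.
Proof.
move=> mf fB; have fi := integrable_bounded mf fB.
have ci c : P.-integrable setT (EFin \o (fun=> c : R)).
  by apply: (@integrable_bounded _ `|c|).
rewrite ler_norml -[- B]Rintegral_cst_probability -{2}[B]Rintegral_cst_probability.
by apply/andP; split; apply: le_Rintegral => // x _; have := fB x; rewrite ler_norml => /andP[].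
Qed.

Lemma integrable_affine (a b : R) f : P.-integrable setT (EFin \o f) ->
  P.-integrable setT (EFin \o (fun x => a + b * f x)).
Proof.
move=> fi; rewrite (_ : _ \o _ =
    (EFin \o cst a) \+ (fun x => b%:E * (EFin \o f) x))%E//.
apply: integrableD => //; last exact: integrableZl.
by apply: (@integrable_bounded _ `|a|).
Qed.

Lemma Rintegral_affine (a b : R) f : P.-integrable setT (EFin \o f) ->
  \int[P]_x (a + b * f x) = a + b * \int[P]_x f x.
Proof.
move=> fi; rewrite RintegralD//; last 2 first.
- by apply: (@integrable_bounded _ `|a|).
- rewrite (_ : _ \o _ = fun x => b%:E * (EFin \o f) x)%E//.
  exact: integrableZl.
by rewrite RintegralZl// Rintegral_cst_probability.
Qed.

(** The quadratic bound on exp is applied to f, which stays below 1, and not to f minus its mean m,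
    which may reach 2. It gives E exp f <= 1 + m + E f^2 <= exp (m + E f^2), and the factor exp (-
    m) recenters. *)
Lemma mgf_centered_le f : measurable_fun setT f -> (forall x, `|f x| <= 1) ->
  (\int[P]_x (expR (f x - \int[P]_z f z))%:E <=
   (expR (\int[P]_x f x ^+ 2))%:E)%E.
Proof.
move=> mf f1; set m := \int[P]_z f z.
have fi := integrable_bounded mf f1.
have mf2 : measurable_fun setT (fun x => f x ^+ 2) by exact: measurable_funX.
have f2i : P.-integrable setT (EFin \o (fun x => f x ^+ 2)).
  apply: (@integrable_bounded _ 1) => // x.
  by rewrite normrX exprn_ile1.
have oi : P.-integrable setT (EFin \o (fun=> 1 : R)).
  by apply: (@integrable_bounded _ 1) => // x; rewrite normr1.
pose g x := 1 + f x + f x ^+ 2.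
have mg : measurable_fun setT g.
  by apply: measurable_funD => //; exact: measurable_funD.
have gi : P.-integrable setT (EFin \o g).
  apply: (@integrable_bounded _ 3) => // x.
  rewrite /g; apply: le_trans (ler_normD _ _) _; rewrite normrX.
  apply: le_trans (lerD (ler_normD _ _) (exprn_ile1 2 (normr_ge0 _) (f1 x))) _.
  by have := f1 x; rewrite normr1; lra.
have g0 x : 0 <= g x by rewrite (le_trans (expR_ge0 (f x)))// expR_le1DxDsqr// (le_trans (ler_norm _)).
have gE : \int[P]_x g x = 1 + m + \int[P]_x f x ^+ 2.
  rewrite /g RintegralD//; last first.
    apply: (@integrable_bounded _ 2) => [|x]; first exact: measurable_funD.
    by apply: le_trans (ler_normD _ _) _; have := f1 x; rewrite normr1; lra.
  by rewrite RintegralD// Rintegral_cst_probability.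
apply: (@le_trans _ _ (\int[P]_x ((expR (- m))%:E * (g x)%:E))%E).
  apply: ge0_le_integral => //.
  - apply/measurable_EFinP.
    apply: (measurableT_comp (@measurable_expR R)).
    exact: measurable_funB.
  - by apply/measurable_EFinP; exact: measurable_funM.
  - move=> x _; rewrite -EFinM lee_fin addrC expRD ler_wpM2l ?expR_ge0//.
    by rewrite expR_le1DxDsqr// (le_trans (ler_norm _)).
rewrite ge0_integralZl_EFin ?expR_ge0//; last 2 first.
- by move=> x _; rewrite lee_fin.
- exact/measurable_EFinP.
rewrite -EFin_Rintegral// -EFinM lee_fin gE.
have -> : expR (\int[P]_x f x ^+ 2) =
    expR (- m) * expR (m + \int[P]_x f x ^+ 2) by rewrite -expRD addKr.
by rewrite ler_wpM2l ?expR_ge0// -addrA expR_ge1Dx.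
Qed.

(** The counterpart of [rademacher_max] under P: each |Z t| lies below an affine function of [G],
    the sum of all the exponentials, and c = ln (2 N) + K makes exp (- c) E G at most 1. *)
Lemma expectation_max_le (I : choiceType) (A : set I) (Z : I -> T -> R)
    (lam K N : R) :
  finite_set A -> 0 < lam -> 0 <= K -> 1 <= N -> (#|` fset_set A|)%:R <= N ->
  (forall t, A t -> measurable_fun setT (Z t)) ->
  (forall t, A t -> (\int[P]_x (expR (lam * Z t x))%:E <= (expR K)%:E)%E) ->
  (forall t, A t -> (\int[P]_x (expR (- lam * Z t x))%:E <= (expR K)%:E)%E) ->
  (\int[P]_x esup [set `|Z t x|%:E | t in A] <= ((ln (2 * N) + K) / lam)%:E)%E.
Proof.
move=> fA lam0 K0 N1 AN mZ ZK ZKN; have N0 : 0 < N by exact: lt_le_trans N1.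
pose c := ln (2 * N) + K.
have c0 : 0 <= c by rewrite addr_ge0// ln_ge0//; lra.
have [A0|/set0P[t0 At0]] := eqVneq A set0.
  rewrite (eq_integral (cst 0%E)) => [|x _]; last first.
    by rewrite A0 image_set0 /esup eqxx.
  by rewrite integral0 lee_fin divr_ge0// ltW.
pose E t x := expR (lam * Z t x) + expR (- lam * Z t x).
have E0 t x : 0 <= E t x by rewrite addr_ge0 ?expR_ge0.
pose G x := \sum_(t <- fset_set A) E t x.
have mE t : A t -> measurable_fun setT (E t).
  move=> At; have mZt := mZ t At.
  by apply: measurable_funD; apply: (measurableT_comp (@measurable_expR R));
    exact: measurable_funM.
(* [E t] is known to be measurable for t in A only; the zero function replaces it elsewhere and
   leaves the sum over [fset_set A] unchanged. *)
have mEF t : measurable_fun setT (fun x => if t \in A then E t x else 0).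
  by have [/set_mem/mE|_] := boolP (t \in A).
have GE x : G x = \sum_(t <- fset_set A) (if t \in A then E t x else 0).
  by apply: eq_big_seq => t; rewrite in_fset_set// => ->.
have ZG t x : A t -> `|Z t x| <= lam^-1 * (c - 1) + lam^-1 * expR (- c) * G x.
  move=> At; rewrite -mulrA -mulrDr ler_pdivlMl// addrC.
  apply: le_trans (le_expR_tangent _ c) _; rewrite -addrA lerD2r addrC expRD.
  rewrite ler_wpM2l ?expR_ge0//.
  apply: (@le_trans _ _ (E t x)).
    rewrite -{1}(ger0_norm (ltW lam0)) -normrM /E mulNr.
    by have [h|h] := ger0P (lam * _); rewrite ?lerDl ?lerDr expR_ge0.
  have tF : t \in fset_set A by rewrite in_fset_set//; apply/mem_set.
  rewrite /G (big_rem t tF)/= lerDl.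
  by apply: sumr_ge0 => t' _.
have mG : measurable_fun setT G.
  rewrite (_ : G = fun x => \sum_(t <- fset_set A) (if t \in A then E t x else 0)).
    exact: measurable_sum.
  exact/funext.
apply: (@le_trans _ _ (\int[P]_x (lam^-1 * (c - 1) + lam^-1 * expR (- c) * G x)%:E)%E).
  apply: ge0_le_integral => //.
  - by move=> x _; apply: esup_ge0 => _ [t _ <-]; rewrite lee_fin.
  - apply: measurable_esup; first exact: finite_set_countable.
    move=> t At; apply/measurable_EFinP; apply: measurableT_comp => //.
    exact: mZ.
  - apply/measurable_EFinP; apply: measurable_funD => //.
    exact: measurable_funM.
  - move=> x _; apply: esup_le; last by move=> _ [t At <-]; rewrite lee_fin ZG.
    by rewrite lee_fin (le_trans _ (ZG _ x At0)).
have GK : (\int[P]_x (G x)%:E <= (2 * N * expR K)%:E)%E.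
  under eq_integral do rewrite GE -sumEFin.
  rewrite ge0_integral_sum//; last 2 first.
  - by move=> t; exact/measurable_EFinP.
  - by move=> t x _; rewrite lee_fin; case: ifP.
  apply: (@le_trans _ _ (\sum_(t <- fset_set A) (2 * expR K)%:E)%E).
    rewrite big_seq [leRHS]big_seq; apply: lee_sum => t.
    rewrite in_fset_set// => tA; rewrite tA; move/set_mem : tA => At.
    rewrite /E; under eq_integral do rewrite EFinD.
    have mexp a : measurable_fun setT (fun x => (expR (a * Z t x))%:E).
      apply/measurable_EFinP; apply: (measurableT_comp (@measurable_expR R)).
      by apply: measurable_funM => //; exact: mZ.
    rewrite ge0_integralD//; try by move=> x _; rewrite lee_fin expR_ge0.
    rewrite mulr_natl mulr2n EFinD; apply: leeD; [exact: ZK|exact: ZKN].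
  rewrite sumEFin lee_fin big_const_seq count_predT iter_addr_0.
  by rewrite -[X in X <= _]mulr_natr mulrAC ler_wpM2r ?expR_ge0// ler_wpM2l.
have Gi : P.-integrable setT (EFin \o G).
  apply/integrableP; split; first exact/measurable_EFinP.
  under eq_integral do rewrite /= ger0_norm ?sumr_ge0//.
  by apply: le_lt_trans GK _; rewrite ltry.
rewrite -EFin_Rintegral; last exact: integrable_affine.
rewrite Rintegral_affine// lee_fin [leRHS]mulrC -mulrA -mulrDr.
rewrite ler_wpM2l ?invr_ge0 ?(ltW lam0)//.
move: GK; rewrite -EFin_Rintegral// lee_fin => GK.
have : expR (- c) * \int[P]_x G x <= 1.
  rewrite expRN ler_pdivrMl ?expR_gt0// mulr1 /c expRD lnK// posrE; lra.
by rewrite -/c; lra.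
Qed.

End bounded_expectation.

Section independent_coordinates.
Variables (R : realType) (n : nat) (d : 'I_n -> measure_display).
Variable X : forall i, measurableType (d i).
Variable P : probability (sampleType X) R.
Hypothesis P_rect : forall A : (forall i, set (X i)),
  (forall i, measurable (A i)) ->
  (P [set x : sampleType X | forall i, A i (x i)] =
   \prod_(i < n) P [set x : sampleType X | A i (x i)])%E.

Lemma mgf_sum_centered_le (g : forall i, X i -> R) :
  (forall i, measurable_fun setT (g i)) -> (forall i y, `|g i y| <= 1) ->
  (\int[P]_x (expR (\sum_(i < n) (g i (x i) - \int[P]_z g i (z i))))%:E <=
   (expR (\sum_(i < n) \int[P]_x g i (x i) ^+ 2))%:E)%E.
Proof.
move=> mg g1; pose m i := \int[P]_z g i (z i).
have mgx i : measurable_fun setT (fun x : sampleType X => g i (x i)).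
  have h := measurableT_comp (mg i) (measurable_coord (i := i)); exact: h.
have m1 i : `|m i| <= 1.
  by apply: (@normr_Rintegral_le _ _ _ _ _ 1) => // x; exact: g1.
pose f i y := expR (g i y - m i).
under eq_integral do rewrite expR_sum.
rewrite (@expectation_prod _ _ _ _ _ P_rect f (expR 2)); last 2 first.
- move=> i; apply: (measurableT_comp (@measurable_expR R)).
  exact: measurable_funB.
- move=> i y; rewrite expR_ge0 ler_expR.
  by have := g1 i y; have := m1 i; rewrite !ler_norml => /andP[? ?] /andP[? ?]; lra.
have H i := @mgf_centered_le _ _ _ P (fun x => g i (x i)) (mgx i) (fun x => g1 i (x i)).
have fin i : (\int[P]_x (f i (x i))%:E)%E \is a fin_num.
  rewrite ge0_fin_numE; first exact: le_lt_trans (H i) (ltry _).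
  by apply: integral_ge0 => x _; rewrite lee_fin expR_ge0.
rewrite (eq_bigr (fun i => (fine (\int[P]_x (f i (x i))%:E))%:E)); last first.
  by move=> i _; rewrite fineK.
rewrite prodEFin lee_fin expR_sum; apply: ler_prod => i _.
rewrite fine_ge0; last by apply: integral_ge0 => x _; rewrite lee_fin expR_ge0.
by rewrite -lee_fin fineK// H.
Qed.

End independent_coordinates.

Section finite_class.
Variables (R : realType) (n : nat) (d : 'I_n -> measure_display).
Variable X : forall i, measurableType (d i).
Variable mu : forall i, {measure set (X i) -> \bar R}.
Variable P : dens R X -> probability (sampleType X) R.
Hypothesis lawP : forall s, L0 mu s -> is_law mu s (P s).
Implicit Types s sb t : dens R X.

Lemma measurable_psi_ratio sb t i : L0 mu sb -> L0 mu t ->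
  measurable_fun setT (fun x : sampleType X => psi_ratio sb t x i).
Proof.
move=> Lsb Lt.
have h := measurableT_comp (measurable_psi_comp (i := i) Lsb Lt) (measurable_coord (i := i)).
exact: h.
Qed.

Lemma integrable_psi_ratio s sb t i : L0 mu sb -> L0 mu t ->
  (P s).-integrable setT (EFin \o (fun x => psi_ratio sb t x i)).
Proof.
move=> Lsb Lt; apply: (@integrable_bounded _ _ _ _ _ 1).
  exact: measurable_psi_ratio.
by move=> x; exact: psi_comp_norm_le1.
Qed.

Lemma measurable_Zproc s sb t : L0 mu sb -> L0 mu t ->
  measurable_fun setT (Zproc P s sb t).
Proof.
move=> Lsb Lt; apply: measurable_sum => i; apply: measurable_funB => //.
exact: measurable_psi_ratio.
Qed.

Lemma sum_Rintegral_psi_ratio_sqr_le s sb t : L0 mu s -> L0 mu sb -> L0 mu t ->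
  \sum_(i < n) \int[P s]_x psi_ratio sb t x i ^+ 2 <=
  3 * (hsq mu s t + hsq mu s sb).
Proof.
move=> Ls Lsb Lt; rewrite addrC /hsq -big_split/= mulr_sumr.
apply: ler_sum => i _; rewrite -lee_fin EFin_Rintegral.
  exact: (integral_psi_comp_sqr_le Ls (lawP Ls) i Lsb Lt).
apply: (@integrable_bounded _ _ _ _ _ 1).
  by apply: measurable_funX; exact: measurable_psi_ratio.
by move=> x; rewrite normrX exprn_ile1//; exact: psi_comp_norm_le1.
Qed.

(** lam is signed so that both tails are covered; |lam| <= 1 keeps lam psi in [-1, 1], where the
    exponential bound applies. *)
Lemma mgf_Zproc_le s sb t (lam y : R) : L0 mu s -> L0 mu sb -> L0 mu t ->
  `|lam| <= 1 -> hsq mu s t + hsq mu s sb <= y ^+ 2 ->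
  (\int[P s]_x (expR (lam * Zproc P s sb t x))%:E <=
   (expR (3 * lam ^+ 2 * y ^+ 2))%:E)%E.
Proof.
move=> Ls Lsb Lt lam1 hy.
pose g i y := lam * psi_comp sb t (i := i) y.
apply: (@le_trans _ _ (\int[P s]_x
    (expR (\sum_(i < n) (g i (x i) - \int[P s]_z g i (z i))))%:E)%E).
  rewrite le_eqVlt; apply/orP; left; apply/eqP; apply: eq_integral => x _.
  congr (expR _)%:E; rewrite mulr_sumr; apply: eq_bigr => i _.
  rewrite mulrBr /g; congr (_ - _); rewrite RintegralZl//.
  exact: integrable_psi_ratio.
apply: le_trans (mgf_sum_centered_le _ _ _) _.
- exact: law_rectangle (lawP Ls).
- by move=> i; apply: measurable_funM => //; exact: measurable_psi_comp.
- move=> i z; rewrite normrM mulr_ile1//; exact: psi_comp_norm_le1.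
rewrite lee_fin ler_expR.
have E i : \int[P s]_x g i (x i) ^+ 2 = lam ^+ 2 * \int[P s]_x psi_ratio sb t x i ^+ 2.
  rewrite -RintegralZl//; first by apply: eq_Rintegral => x _; rewrite exprMn.
  apply: (@integrable_bounded _ _ _ _ _ 1).
    by apply: measurable_funX; exact: measurable_psi_ratio.
  by move=> x; rewrite normrX exprn_ile1//; exact: psi_comp_norm_le1.
under eq_bigr do rewrite E.
rewrite -mulr_sumr.
have := le_trans (sum_Rintegral_psi_ratio_sqr_le Ls Lsb Lt) (ler_wpM2l (ler0n R 3) hy).
by move=> /(ler_wpM2l (sqr_ge0 lam)); rewrite mulrCA mulrA.
Qed.

Lemma wS_finite_le S s sb (y lam N : R) : S `<=` L0 mu -> L0 mu s -> L0 mu sb ->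
  finite_set (BS mu S s sb y) -> (#|` fset_set (BS mu S s sb y)|)%:R <= N ->
  1 <= N -> 0 < lam -> lam <= 1 ->
  (wS mu P S s sb y <= (ln (2 * N) / lam + 3 * lam * y ^+ 2)%:E)%E.
Proof.
move=> SL Ls Lsb fB BN N1 lam0 lam1.
have -> : ln (2 * N) / lam + 3 * lam * y ^+ 2 =
    (ln (2 * N) + 3 * lam ^+ 2 * y ^+ 2) / lam.
  by field; rewrite gt_eqF.
apply: expectation_max_le => //.
- by rewrite mulr_ge0 ?sqr_ge0// mulr_ge0 ?sqr_ge0.
- by move=> t [St _]; apply: measurable_Zproc => //; exact: SL.
- move=> t [St ty]; apply: mgf_Zproc_le => //; first exact: SL.
  by rewrite ger0_norm// ltW.
- move=> t [St ty]; rewrite -[lam ^+ 2]sqrrN; apply: mgf_Zproc_le => //.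
    exact: SL.
  by rewrite normrN ger0_norm// ltW.
Qed.

End finite_class.

(** * Models with bounded metric dimension *)

Section metric_dimension.
Variable R : realType.

Lemma c0_gt0 : 0 < c0 R.
Proof.
rewrite /c0 mulr_gt0// subr_gt0 invf_lt1 ?sqrtr_gt0//.
by rewrite -[ltLHS]sqrtr1 ltr_sqrt// ltr1n.
Qed.

Lemma c0_le : c0 R <= 8^-1.
Proof. by rewrite /c0 ler_piMr// gerBl invr_ge0 sqrtr_ge0. Qed.

Variables (n : nat) (d : 'I_n -> measure_display).
Variable X : forall i, measurableType (d i).
Variable mu : forall i, {measure set (X i) -> \bar R}.
Variable P : dens R X -> probability (sampleType X) R.
Hypothesis lawP : forall s, L0 mu s -> is_law mu s (P s).
Implicit Types (Dt : R -> \bar R) (Sb : set (dens R X)).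

Lemma lne_counting_le (T : choiceType) (A : set T) (L : R) :
  (lne (@counting T R A) <= L%:E)%E ->
  finite_set A /\ (#|` fset_set A|)%:R <= expR L.
Proof.
rewrite /counting; case: ifPn => [/asboolP fA|_ /=]; last by rewrite leye_eq.
move=> h; split => //; move: h; rewrite /=.
case: ifPn => [A0 _|]; first exact: le_trans A0 (expR_ge0 _).
by rewrite -ltNge lee_fin => A0 h; rewrite -[leLHS]lnK ?ler_expR.
Qed.

(* Above the radius 2 e, the choice lam = c0 / 6 in [wS_finite_le] leaves the
   condition ln (2 N) <= c0 ^ 2 y ^ 2 / 12, where ln N <= 8 c0 ^ 2 y ^ 2 / 131 and
   c0 ^ 2 y ^ 2 >= 131 / 4; hence the need for ln 2 <= 8 / 11. *)
Lemma Dmodel_metric_dimension_le Dt Sb (e : R) : Sb `<=` L0 mu -> dimension_function n Dt ->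
  metric_dimension_bounded mu Sb Dt -> 0 < e ->
  ((e ^- 2)%:E * Dt e <= (8 * c0 R ^+ 2 / 131)%:E)%E ->
  (Dmodel mu P Sb <= (2 * (c1 R + 2 * c2 R) * e ^+ 2)%:E)%E.
Proof.
move=> SbL [Dt2 _ _] hSb e0 he; have [N [NL cN hN] hy] := hSb e e0.
have [S [SN iS hS]] := exists_identifiable_subset NL cN.
have [D DE] : exists D, Dt e = D%:E.
  move: he (Dt2 e e0); case: (Dt e) => [D| |]//=; first by exists D.
  by rewrite gt0_muley ?lte_fin ?invr_gt0 ?exprn_gt0// leye_eq.
have D2 : 2^-1 <= D by rewrite -lee_fin -DE Dt2.
have c00 := c0_gt0.
have hD : D <= 8 * c0 R ^+ 2 / 131 * e ^+ 2.
  move: he; rewrite DE -EFinM lee_fin => he.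
  by rewrite -ler_pdivrMr ?exprn_gt0// mulrC.
(* The lower bound 1/2 on [Dt] forces e to be large. This makes ln 2 small against c0^2 y^2 and also
   ensures 4 e^2 >= 1, as [DS_le] requires. *)
have he131 : 131 <= 16 * (c0 R ^+ 2 * e ^+ 2) by lra.
(* The first term is the approximation of [Sb] within e; the second is D^S <= (2 e)^2, the entropy
   bound being available from the radius 2 e on. *)
rewrite [leRHS](_ : _ = (2 * c1 R * e ^+ 2 + c2 R * (4 * e ^+ 2))%:E); last first.
  by congr EFin; ring.
have SL : S `<=` L0 mu by case: iS.
apply: Dmodel_le iS _ _ _; first exact: ltW.
  move=> t St; rewrite hS; last exact: SbL.
  by apply: le_trans hN; apply: esup_ub; exists t.
have h0 : 0 <= c0 R ^+ 2 by exact: sqr_ge0.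
apply: DS_le; first by have := c0_le; nra.
move=> s sb y Ls Ssb y0 ey.
have ey2 : 2 * e <= y.
  by rewrite -(ler_pXn2r (n := 2))// ?nnegrE ?mulr_ge0// ?ltW// exprMn; lra.
pose L := 8 / 131 * (c0 R ^+ 2 * y ^+ 2).
have L2 : 131 / 4 <= c0 R ^+ 2 * y ^+ 2.
  have : c0 R ^+ 2 * (4 * e ^+ 2) <= c0 R ^+ 2 * y ^+ 2 by rewrite ler_wpM2l// ltW.
  by lra.
have [fA NA] : finite_set (N `&` hball mu s y) /\
    (#|` fset_set (N `&` hball mu s y)|)%:R <= expR L.
  apply: lne_counting_le; apply: (@le_trans _ _ (((y / e) ^+ 2)%:E * Dt e)%E).
    by apply: le_trans (hy y ey2); apply: esup_ub; exists s.
  rewrite DE -EFinM lee_fin expr_div_n mulrAC ler_pdivrMr ?exprn_gt0//.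
  apply: le_trans (ler_wpM2l (sqr_ge0 y) hD) _.
  by rewrite le_eqVlt; apply/orP; left; apply/eqP; rewrite /L; field.
have BA : BS mu S s sb y `<=` N `&` hball mu s y.
  move=> t [St ty]; split; first exact: SN.
  split; first exact: SL.
  by apply: hdist_le => //; apply: le_trans ty; rewrite lerDl hsq_ge0.
have fB := sub_finite_set BA fA.
have L0' : 0 <= L by rewrite /L; lra.
apply: le_trans (@wS_finite_le _ _ _ _ mu P lawP S s sb y (c0 R / 6) (expR L) _ _ _ _ _ _ _ _) _ => //.
- exact: SL.
- apply: le_trans NA; rewrite ler_nat; apply: fsubset_leq_card.
  by rewrite -fset_set_sub.
- by rewrite -expR0 ler_expR.
- by rewrite divr_gt0.
- by have := c0_le; lra.
rewrite lee_fin lnM ?posrE ?expR_gt0// expRK.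
have ln2 := ln2_le R.
rewrite -lerBrDr ler_pdivrMr ?divr_gt0//.
rewrite [leRHS](_ : _ = c0 R ^+ 2 * y ^+ 2 / 12); last by field.
by rewrite /L; lra.
Qed.

(** The bound at an admissible e is continuous in e, hence passes to the infimum. *)
Lemma Dmodel_etabar_le Dt Sb : Sb `<=` L0 mu -> dimension_function n Dt ->
  metric_dimension_bounded mu Sb Dt ->
  (Dmodel mu P Sb <= (2 * (c1 R + 2 * c2 R) * etabar Dt ^+ 2)%:E)%E.
Proof.
move=> SbL hDt hSb; rewrite /etabar; set E := (X in inf X).
have DE e : E e -> (Dmodel mu P Sb <= (2 * (c1 R + 2 * c2 R) * e ^+ 2)%:E)%E.
  by move=> [e0 he]; exact: Dmodel_metric_dimension_le he.
have E0 : E !=set0.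
  have q0 : 0 < 8 * c0 R ^+ 2 / 131 by rewrite divr_gt0// mulr_gt0// exprn_gt0// c0_gt0.
  pose q := 8 * c0 R ^+ 2 / 131.
  (* Beyond sqrt n the value of [Dt] is 1/2; the other two terms give e >= 1 and e >= q^-1, hence
     e^-2 <= e^-1 <= q. *)
  exists (Num.sqrt n%:R + 1 + q^-1).
  have s0 : 0 <= Num.sqrt n%:R :> R by exact: sqrtr_ge0.
  have qi0 : 0 < q^-1 by rewrite invr_gt0.
  set e := Num.sqrt n%:R + 1 + q^-1.
  have e1 : 1 <= e by rewrite /e; lra.
  have qe : q^-1 <= e by rewrite /e; lra.
  split; first by rewrite (lt_le_trans _ e1).
  have [_ _ ->] := hDt; last by rewrite /e; lra.
  rewrite -EFinM lee_fin -/q.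
  have : e ^- 2 <= q.
    rewrite expr2 invfM; apply: (@le_trans _ _ (1 * e^-1)).
      by rewrite ler_wpM2r ?invr_ge0 ?(le_trans _ e1)// invf_le1// (lt_le_trans _ e1).
    by rewrite mul1r invf_ple// ?posrE// (lt_le_trans _ e1).
  have : 0 <= e ^- 2 by rewrite invr_ge0 sqr_ge0.
  by lra.
have lbE : lbound E 0 by move=> e [/ltW].
have hE : has_inf E by split => //; exists 0.
have i0 : 0 <= inf E by exact: lb_le_inf.
set K := 2 * (c1 R + 2 * c2 R).
have K0 : 0 < K.
  by rewrite /K; have := c1_ge0 R; have := c2_gt0 R; lra.
apply/lee_addgt0Pr => eps eps0; rewrite -EFinD.
(* As del <= 1, replacing inf E by inf E + del raises K (inf E)^2 by at most K del (2 inf E + 1) <=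
   eps. *)
pose del := Num.min 1 (eps / (K * (2 * inf E + 1))).
have Ki : 0 < K * (2 * inf E + 1) by rewrite mulr_gt0//; lra.
have del0 : 0 < del by rewrite lt_min ltr01 divr_gt0.
have [e Ee ei] := inf_adherent del0 hE.
apply: (le_trans (DE e Ee)); rewrite lee_fin -/K.
have ie : 0 <= e by case: Ee => /ltW.
have d1 : del <= 1 by rewrite ge_min lexx.
have dK : del * (K * (2 * inf E + 1)) <= eps.
  by rewrite -ler_pdivlMr// ge_min lexx orbT.
apply: (@le_trans _ _ (K * (inf E + del) ^+ 2)).
  by rewrite ler_pM2l// lerXn2r ?nnegrE ?(ltW ei)// addr_ge0// ltW.
have : K * (del * del) <= K * (del * 1).
  by rewrite ler_pM2l// ler_wpM2l// ltW.
by rewrite sqrrD mulr2n; lra.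
Qed.

End metric_dimension.

(** * Symmetrization *)

Lemma eq_pushforward_generators d d' (T1 : measurableType d)
    (T2 : measurableType d') (R : realType) (m : {measure set T1 -> \bar R})
    (f g : T1 -> T2) (G : set (set T2)) : (m setT < +oo)%E ->
  measurable_fun setT f -> measurable_fun setT g ->
  @measurable _ T2 = <<s G >> -> setI_closed G -> G setT ->
  (forall A, G A -> m (f @^-1` A) = m (g @^-1` A)) ->
  forall A, measurable A -> m (f @^-1` A) = m (g @^-1` A).
Proof.
move=> moo mf mg GE GI GT H A mA.
have push h : measurable_fun setT h ->
    exists m' : {measure set T2 -> \bar R}, forall B, m' B = m (h @^-1` B).
  by move=> mh; unshelve eexists (pushforward m h : {measure set T2 -> \bar R}).
have [mf' mfE] := push f mf; have [mg' mgE] := push g mg.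
rewrite -mfE -mgE; apply: (@measure_unique _ _ _ G (fun=> setT)) => //.
- by rewrite bigcup_const.
- by move=> B GB; rewrite mfE mgE H.
- by move=> _; rewrite mfE preimage_setT.
Qed.

Section symmetrization.
Variables (R : realType) (n : nat) (d : 'I_n -> measure_display).
Variable X : forall i, measurableType (d i).
Let T := sampleType X.

Lemma measurable_fun_sampleType d0 (Y : measurableType d0) (f : Y -> T) :
  (forall i, measurable_fun setT (fun y => f y i)) -> measurable_fun setT f.
Proof.
move=> mf; have h := @measurability _ _ Y T setT f (cylinders (X := X)) erefl.
apply: h.
move=> _ [_ [i [A [mA ->]]] <-].
exact: mf.
Qed.

Definition pair_rectangle (A B : forall i, set (X i)) : set (T * T) :=
  [set z | forall i, A i (z.1 i) /\ B i (z.2 i)].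

Definition pair_rectangles : set (set (T * T)) :=
  [set C | exists A B, [/\ forall i, measurable (A i),
     forall i, measurable (B i) & C = pair_rectangle A B]].

Lemma pair_rectangleE A B : pair_rectangle A B =
  [set x : T | forall i, A i (x i)] `*` [set x : T | forall i, B i (x i)].
Proof.
apply/seteqP; split => z /=; first by move=> H; split => i; case: (H i).
by move=> [HA HB] i; split.
Qed.

Lemma measurable_pair_rectangles :
  @measurable _ (T * T)%type = <<s pair_rectangles >>.
Proof.
apply/seteqP; split; last first.
  apply: smallest_sub; first exact: sigma_algebra_measurable.
  move=> _ [A [B [mA mB ->]]]; rewrite pair_rectangleE.
  by apply: measurableX; exact: measurable_rectangle.
pose TG := g_sigma_algebraType pair_rectangles.
(* The identity out of [TG] is measurable because each coordinate is: its preimages are pair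
   rectangles whose other sides are all full. *)
have mid : measurable_fun setT (fun z : TG => (z : T * T)).
  apply/measurable_fun_pairP; split; apply: measurable_fun_sampleType => i _ A mA;
    rewrite setTI; apply: sub_sigma_algebra.
    exists (dfwith (fun j => [set: X j]) i A), (fun j => [set: X j]); split => //.
      move=> j; have [->|ji] := eqVneq j i; rewrite ?dfwithin// dfwithout//.
      by rewrite eq_sym.
    apply/seteqP; split => z /=.
      move=> Az j; split => //; have [->|ji] := eqVneq j i; rewrite ?dfwithin//.
      by rewrite dfwithout// eq_sym.
    by move=> /(_ i)[]; rewrite dfwithin.
  exists (fun j => [set: X j]), (dfwith (fun j => [set: X j]) i A); split => //.
    move=> j; have [->|ji] := eqVneq j i; rewrite ?dfwithin// dfwithout//.
    by rewrite eq_sym.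
  apply/seteqP; split => z /=.
    move=> Az j; split => //; have [->|ji] := eqVneq j i; rewrite ?dfwithin//.
    by rewrite dfwithout// eq_sym.
  by move=> /(_ i)[]; rewrite dfwithin.
by move=> C mC; have := mid measurableT C mC; rewrite setTI.
Qed.

(** Exchanging the i-th coordinates flips the sign of f (x i) - f (z i), so swaps realize the
    Rademacher signs on the product space, with no further source of randomness. *)
Definition swap (e : 'I_n -> bool) (z : T * T) : T * T :=
  ((fun i => if e i then z.2 i else z.1 i) : T,
   (fun i => if e i then z.1 i else z.2 i) : T).

Lemma measurable_coord1 i : measurable_fun setT (fun z : T * T => z.1 i).
Proof.
have h := measurableT_comp (measurable_coord (i := i))
  (@measurable_fst _ _ T T); exact: h.
Qed.

Lemma measurable_coord2 i : measurable_fun setT (fun z : T * T => z.2 i).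
Proof.
have h := measurableT_comp (measurable_coord (i := i))
  (@measurable_snd _ _ T T); exact: h.
Qed.

Lemma measurable_swap e : measurable_fun setT (swap e).
Proof.
apply: measurable_fun_pair; apply: measurable_fun_sampleType => i;
  case: (e i); (exact: measurable_coord1 || exact: measurable_coord2).
Qed.

Variable P : probability T R.
Hypothesis P_rect : forall A : (forall i, set (X i)),
  (forall i, measurable (A i)) ->
  (P [set x : T | forall i, A i (x i)] =
   \prod_(i < n) P [set x : T | A i (x i)])%E.

Lemma pair_rectangle_measure A B :
  (forall i, measurable (A i)) -> (forall i, measurable (B i)) ->
  ((P \x P) (pair_rectangle A B) =
   \prod_(i < n) (P [set x : T | A i (x i)] * P [set x : T | B i (x i)]))%E.
Proof.
move=> mA mB; rewrite pair_rectangleE.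
transitivity (P [set x : T | forall i, A i (x i)] *
  P [set x : T | forall i, B i (x i)])%E.
  by apply: product_measure1E; exact: measurable_rectangle.
by rewrite !P_rect// -big_split.
Qed.

Lemma swap_measure e (C : set (T * T)) : measurable C ->
  (P \x P)%E (swap e @^-1` C) = (P \x P)%E C.
Proof.
move=> mC; transitivity ((P \x P)%E (id @^-1` C)); last by rewrite preimage_id.
revert mC; move: C; apply: (@eq_pushforward_generators _ _ _ _ _ (P \x P)%E (swap e) id pair_rectangles) => //.
- have PP1 : (P \x P)%E ([set: T] `*` [set: T]) = 1%E.
    rewrite product_measure1E// -[RHS]mule1.
    by congr (_ * _)%E; exact: probability_setT.
  apply: (@le_lt_trans _ _ ((P \x P)%E ([set: T] `*` [set: T]))).
    by rewrite setXTT.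
  by rewrite PP1 ltry.
- exact: measurable_swap.
- exact: measurable_pair_rectangles.
- move=> _ _ [A [B [mA mB ->]]] [A' [B' [mA' mB' ->]]].
  exists (fun i => A i `&` A' i), (fun i => B i `&` B' i); split.
  + by move=> i; exact: measurableI.
  + by move=> i; exact: measurableI.
  + apply/seteqP; split => z /=.
      by move=> [H H'] i; case: (H i) (H' i) => ? ? [].
    by move=> H; split => i; case: (H i) => -[? ?] [].
- exists (fun=> setT), (fun=> setT); split => //.
  by apply/seteqP; split.
move=> _ [A [B [mA mB ->]]].
(* The preimage of a pair rectangle has its two sides exchanged wherever e holds, and the product
   formula for its measure is symmetric in them. *)
pose A' i := if e i then B i else A i.
pose B' i := if e i then A i else B i.
have -> : swap e @^-1` pair_rectangle A B = pair_rectangle A' B'.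
  apply/seteqP; split => z /= H i; have := H i; rewrite /A' /B' /=;
  by case: (e i) => -[].
have mA' i : measurable (A' i) by rewrite /A'; case: (e i).
have mB' i : measurable (B' i) by rewrite /B'; case: (e i).
rewrite preimage_id.
apply: (etrans (pair_rectangle_measure mA' mB')).
apply: (etrans _ (esym (pair_rectangle_measure mA mB))).
by apply: eq_bigr => i _; rewrite /A' /B'; case: (e i) => //; rewrite muleC.
Qed.

Lemma integral_swap e (F : T * T -> \bar R) : measurable_fun setT F ->
  (forall z, (0 <= F z)%E) ->
  (\int[P \x P]_z F (swap e z) = \int[P \x P]_z F z)%E.
Proof.
move=> mF F0.
transitivity (\int[P \x P]_z (1%:E * F (swap e z)))%E.
  by apply: eq_integral => z _; rewrite mul1e.
transitivity (\int[P \x P]_z (1%:E * F z))%E; last first.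
  by apply: eq_integral => z _; rewrite mul1e.
apply: (@eq_integral_weighted_comp _ _ _ F _ _ _ _ _ (swap e) (fun=> 1) _ _ _ id (fun=> 1)) => //.
  exact: measurable_swap.
move=> A mA.
transitivity ((P \x P)%E (swap e @^-1` A)).
  rewrite -[X in (_ \x _)%E X]setIT -integral_indic//.
    by apply: eq_integral => z _; rewrite mul1e !indicE.
  by rewrite -[X in measurable X]setTI; exact: measurable_swap.
rewrite swap_measure// -[X in (_ \x _)%E X]setIT -integral_indic//.
by apply: eq_integral => z _; rewrite mul1e.
Qed.

End symmetrization.

Section symmetrization_inequality.
Variables (R : realType) (n : nat) (d : 'I_n -> measure_display).
Variable X : forall i, measurableType (d i).
Let T := sampleType X.
Variable P : probability T R.

Lemma Rintegral_sum (g : 'I_n -> T -> R) :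
  (forall i, P.-integrable setT (EFin \o g i)) ->
  P.-integrable setT (EFin \o (fun x => \sum_i g i x)) /\
  \int[P]_x (\sum_i g i x) = \sum_i \int[P]_x g i x.
Proof.
move=> gi; elim: (index_enum _) => [|i r [IHi IHE]].
  split; last by under eq_Rintegral do rewrite big_nil; rewrite big_nil Rintegral_cst_probability.
  apply: (@integrable_bounded _ _ _ _ _ 0).
    by rewrite (_ : (fun x => _) = cst 0)//; apply/funext => x; rewrite big_nil.
  by move=> x; rewrite big_nil normr0.
have E : (fun x => \sum_(j <- i :: r) g j x) = (fun x => g i x + \sum_(j <- r) g j x).
  by apply/funext => x; rewrite big_cons.
rewrite E; split.
  rewrite (_ : _ \o _ = ((EFin \o g i) \+ (EFin \o (fun x => (\sum_(j <- r) g j x)%R)))%E)//.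
  exact: integrableD.
by rewrite RintegralD// big_cons IHE.
Qed.

Hypothesis P_rect : forall A : (forall i, set (X i)),
  (forall i, measurable (A i)) ->
  (P [set x : T | forall i, A i (x i)] =
   \prod_(i < n) P [set x : T | A i (x i)])%E.

(** The last hypothesis is a bound at fixed samples x and z. It asks for some [H] dominating all t,
    and its right-hand side depends on (x, z) through v alone, which is what gets integrated; the
    factor 2 counts the two samples. *)
Lemma symmetrized_expectation_le (I : Type) (A : set I)
    (f : I -> forall i, X i -> R) (v : T -> R) (K0 K1 M : R) :
  countable A ->
  (forall t i, A t -> measurable_fun setT (f t i)) ->
  (forall t i y, A t -> `|f t i y| <= 1) ->
  measurable_fun setT v -> (forall x, 0 <= v x <= M) -> 0 <= K0 -> 0 <= K1 ->
  (forall x z : T, exists2 H : {ffun 'I_n -> bool} -> R,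
     forall (e : {ffun 'I_n -> bool}) t, A t ->
       `|\sum_i (-1) ^+ e i * (f t i (x i) - f t i (z i))| <= H e &
     2 ^- n * \sum_(e : {ffun 'I_n -> bool}) H e <= K0 + K1 * (v x + v z)) ->
  (\int[P]_x esup [set `|\sum_i (f t i (x i) - \int[P]_z f t i (z i))|%:E | t in A]
   <= (K0 + 2 * K1 * \int[P]_x v x)%:E)%E.
Proof.
move=> cA mf f1 mv v0M K00 K10 HH.
have v0 x : 0 <= v x by case/andP: (v0M x).
have iv0 : 0 <= \int[P]_x v x by exact: Rintegral_ge0.
have [A0|/set0P[t0 At0]] := eqVneq A set0.
  rewrite (eq_integral (cst 0%E)) => [|x _]; last first.
    by rewrite A0 image_set0 /esup eqxx.
  by rewrite integral0 lee_fin addr_ge0// !mulr_ge0.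
pose D t (z : T * T) := \sum_i (f t i (z.1 i) - f t i (z.2 i)).
pose G z := esup [set `|D t z|%:E | t in A].
have mD t : A t -> measurable_fun setT (D t).
  move=> At; apply: measurable_sum => i; apply: measurable_funB.
    have h := measurableT_comp (mf t i At) (measurable_coord1 (i := i)); exact: h.
  have h := measurableT_comp (mf t i At) (measurable_coord2 (i := i)); exact: h.
have mG : measurable_fun setT G.
  apply: measurable_esup => // t At; apply/measurable_EFinP.
  by apply: measurableT_comp => //; exact: mD.
have G0 z : (0 <= G z)%E by apply: esup_ge0 => _ [t _ <-]; rewrite lee_fin.
have mfx t i : A t -> measurable_fun setT (fun x : T => f t i (x i)).
  by move=> At; have h := measurableT_comp (mf t i At) (measurable_coord (i := i)); exact: h.
have fi t i : A t -> P.-integrable setT (EFin \o (fun x : T => f t i (x i))).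
  move=> At; apply: (@integrable_bounded _ _ _ _ _ 1); first exact: mfx.
  by move=> x; exact: f1.
have mGx : measurable_fun setT (fun x => \int[P]_z G (x, z))%E.
  exact: measurable_fun_fubini_tonelli_F.
(* Each mean is an integral over an independent sample z, and both the absolute value and the
   supremum can be moved inside it at the cost of an inequality. *)
apply: (@le_trans _ _ (\int[P]_x \int[P]_z G (x, z))%E).
  apply: ge0_le_integral => //.
  - by move=> x _; apply: esup_ge0 => _ [t _ <-]; rewrite lee_fin.
  - apply: measurable_esup => // t At; apply/measurable_EFinP.
    apply: measurableT_comp => //; apply: measurable_sum => i.
    by apply: measurable_funB => //; exact: mfx.
  - move=> x _; apply: esup_le; first by apply: integral_ge0 => z _.
    move=> _ [t At <-].
    have [Fi FE] := Rintegral_sum (fun i => fi t i At).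
    pose F (z : T) := \sum_i f t i (z i).
    have -> : \sum_i (f t i (x i) - \int[P]_z f t i (z i)) =
        \int[P]_z (F x + -1 * F z).
      by rewrite Rintegral_affine// FE sumrB mulN1r.
    have FDi := integrable_affine (F x) (-1) Fi.
    apply: (@le_trans _ _ (\int[P]_z `|F x + -1 * F z|)%:E).
      by rewrite lee_fin; apply: le_normr_Rintegral.
    rewrite EFin_Rintegral; last exact: integrable_norm.
    apply: ge0_le_integral => //.
    + apply/measurable_EFinP; apply: measurableT_comp => //.
      apply: measurable_funD => //; apply: measurable_funM => //.
      by apply: measurable_sum => i; exact: mfx.
    + by have := measurableT_comp mG (measurable_pair1 x).
    + move=> z _; rewrite /G; apply: esup_ub; exists t => //.
      by congr (`|_|%:E); rewrite /D sumrB mulN1r.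
rewrite -[leLHS](fubini_tonelli1 G)//.
pose B z := K0 + K1 * (v z.1 + v z.2).
have mB : measurable_fun setT B.
  apply: measurable_funD => //; apply: measurable_funM => //.
  by apply: measurable_funD; apply: measurableT_comp.
have B0 z : 0 <= B z by rewrite /B addr_ge0// mulr_ge0// addr_ge0.
apply: (@le_trans _ _ (\int[P \x P]_z (B z)%:E)%E); last first.
  rewrite fubini_tonelli1//; last exact/measurable_EFinP.
  have vi : P.-integrable setT (EFin \o v).
    apply: (@integrable_bounded _ _ _ _ _ M) => // x.
    by rewrite ger0_norm//; case/andP: (v0M x).
  have inner x : (\int[P]_z (B (x, z))%:E = (K0 + K1 * \int[P]_z v z + K1 * v x)%:E)%E.
    have BE z : B (x, z) = K0 + K1 * v x + K1 * v z by rewrite /B /= mulrDr addrA.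
    under eq_integral do rewrite BE.
    rewrite -EFin_Rintegral ?Rintegral_affine//; last exact: integrable_affine.
    by rewrite addrAC.
  rewrite /fubini_F; under eq_integral do rewrite inner.
  rewrite -EFin_Rintegral ?Rintegral_affine//; last exact: integrable_affine.
  by rewrite lee_fin; lra.
pose c : R := 2 ^- n.
have c0 : 0 <= c by rewrite invr_ge0 exprn_ge0.
have msw e : measurable_fun setT (fun z => G (swap e z)).
  by apply: measurableT_comp => //; exact: measurable_swap.
(* Every swap preserves the integral, which therefore equals its average over the 2^n swaps; at
   fixed z the integrand is then a Rademacher average. *)
have -> : (\int[P \x P]_z G z =
    \int[P \x P]_z (\sum_(e : {ffun 'I_n -> bool}) c%:E * G (swap e z)))%E.
  rewrite ge0_integral_sum//; last 2 first.
  - by move=> e; apply: emeasurable_funM.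
  - by move=> e z _; rewrite mule_ge0.
  rewrite (eq_bigr (fun=> c%:E * \int[P \x P]_z G z)%E) => [|e _]; last first.
    by rewrite ge0_integralZl_EFin// integral_swap.
  rewrite -ge0_sume_distrl// sumEFin sumr_const card_ffun card_ord card_bool.
  by rewrite -mulr_natr natrX mulVf ?mul1e// expf_neq0.
apply: ge0_le_integral => //.
- by move=> z _; apply: sume_ge0 => e _; rewrite mule_ge0.
- by apply: emeasurable_sum => e; apply: emeasurable_funM.
- exact/measurable_EFinP.
move=> z _; have [H HD Hc] := HH z.1 z.2.
apply: le_trans (_ : ((2 ^- n * \sum_(e : {ffun 'I_n -> bool}) H e)%:E <= _)%E); last first.
  by rewrite lee_fin.
rewrite mulr_sumr -sumEFin; apply: lee_sum => e _.
rewrite EFinM; apply: lee_wpmul2l => //.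
have DH t : A t -> `|D t (swap e z)| <= H e.
  move=> At; apply: le_trans (HD e t At); rewrite le_eqVlt; apply/orP; left.
  apply/eqP; congr `|_|; apply: eq_bigr => i _ /=.
  by case: (e i); rewrite ?expr1 ?expr0 ?mulN1r ?opprB ?mul1r.
apply: esup_le; last by move=> _ [t At <-]; rewrite lee_fin DH.
by rewrite lee_fin (le_trans _ (DH t0 At0)).
Qed.

End symmetrization_inequality.

(** * Discretization of VC-subgraph classes *)

Section vc_trace.
Variables (R : realType) (W I : Type) (C : set I) (h : I -> W -> R).

(* The shattered points are (w k, theta k), where theta k separates the values
   [h t (w k)] with [b t k] from those without. *)
Lemma shatters_subgraph V (w : 'I_V -> W) (b : I -> 'I_V -> bool) :
  (forall t t' k, C t -> C t' -> h t (w k) <= h t' (w k) -> b t k -> b t' k) ->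
  (forall B : {set 'I_V}, exists2 t, C t & forall k, b t k = (k \in B)) ->
  exists A, (A #= `I_V)%card /\
    shatters [set subgraph f | f in [set (fun x => (h t x)%:E) | t in C]] A.
Proof.
move=> bmono bsh.
have /choice[tau tauP] : forall B : {set 'I_V}, exists t,
    C t /\ forall k, b t k = (k \in B).
  by move=> B; have [t Ct tB] := bsh B; exists t.
pose val B k := h (tau B) (w k).
(* Since k is not in [set0], the default value is one of the competitors and [theta k] is a genuine
   maximum over the B avoiding k. By [bmono], the value at any B containing k is strictly larger. *)
pose theta k := \big[Num.max/val (finset.set0) k]_(B : {set 'I_V} | k \notin B) val B k.
have thetaP B k : (theta k < val B k) = (k \in B).
  have [kB|kB] := boolP (k \in B); last first.
    by apply/negbTE; rewrite -leNgt; exact: (le_bigmax_cond _ (fun B => val B k)).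
  have lt (B' : {set 'I_V}) : k \notin B' -> val B' k < val B k.
    move=> kB'; rewrite ltNge; apply/negP => le.
    have [CB bB] := tauP B; have [CB' bB'] := tauP B'.
    by move: kB'; rewrite -bB' (bmono _ _ _ CB CB' le)// bB.
  by apply/bigmax_ltP; split => [|B']; apply: lt; rewrite ?finset.inE.
pose a k := (w k, theta k).
(* The points w k may coincide. If k and k' also had the same threshold, the singleton of k' could
   not tell them apart. *)
have inj_a : {in [set: 'I_V] &, injective a}.
  move=> k k' _ _ [wk tk]; apply/eqP; rewrite -finset.in_set1.
  rewrite -(thetaP [set k']%SET) /val wk tk.
  by have := thetaP [set k']%SET k'; rewrite finset.set11.
exists (range a); split.
  apply: card_eq_trans (inj_card_eq (A := [set: 'I_V]) inj_a) _.
  by rewrite card_eq_sym; exact: card_II.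
move=> B BA; pose B' := [set k | a k \in B]%SET.
exists (subgraph (fun x => (h (tau B') x)%:E)).
  by exists (fun x => (h (tau B') x)%:E) => //; exists (tau B') => //; case: (tauP B').
apply/seteqP; split => [p [] + [k _ pk]|p Bp].
  rewrite -pk /subgraph/= lte_fin => lt.
  have : k \in B' by rewrite -thetaP.
  by rewrite finset.inE => /set_mem.
have [k _ pk] := BA p Bp; split; last by exists k.
rewrite -pk /subgraph/= lte_fin.
have : k \in B' by rewrite finset.inE pk; apply/mem_set.
by rewrite -thetaP.
Qed.

End vc_trace.

Section grid.
Variable R : realType.
Implicit Types a b : R.

Definition grid (K : nat) (k : nat) : R := 2 * k%:R / K%:R - 1.

(** If b - a > 2 / K, the first grid point above a lies strictly below b, hence compares differently
    with a and b; its index is less than K because b <= 1. *)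
Lemma grid_close K a b : (0 < K)%N -> `|a| <= 1 -> `|b| <= 1 ->
  (forall k : 'I_K, (grid K k < a) = (grid K k < b)) -> `|a - b| <= 2 / K%:R.
Proof.
move=> K0; wlog ab : a b / a <= b => [H a1 b1 E|].
  have [ab|/ltW ba] := leP a b; first exact: H.
  by rewrite distrC; apply: H.
move=> na nb E; have /andP[a0 a1] : -1 <= a <= 1 by rewrite -ler_norml.
have /andP[b0 b1] : -1 <= b <= 1 by rewrite -ler_norml.
rewrite ler0_norm ?subr_le0// opprB leNgt; apply/negP => dlt.
have K0' : 0 < K%:R :> R by rewrite ltr0n.
pose y := K%:R * (a + 1) / 2.
have y0 : 0 <= y by rewrite /y divr_ge0// mulr_ge0//; lra.
pose k := (Num.truncn y).+1.
have ky : y < k%:R by exact: truncnS_gt.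
have yk : k%:R <= y + 1.
  by rewrite /k -natr1 lerD2r truncn_le.
have gE : K%:R * (grid K k + 1) = 2 * k%:R.
  by rewrite /grid subrK mulrC divfK// gt_eqF.
have ga : a < grid K k.
  rewrite -(ltrD2r 1) -(ltr_pM2l K0') gE; move: ky; rewrite /y; lra.
have gb : grid K k < b.
  rewrite -(ltrD2r 1) -(ltr_pM2l K0') gE.
  have : 2 < K%:R * (b - a) by rewrite mulrC -ltr_pdivrMr.
  by move: yk; rewrite /y; lra.
have kK : (k < K)%N.
  rewrite -(ltr_nat R) -(ltr_pM2l (ltr0n R 2)) -gE.
  have h : K%:R * (grid K k + 1) < K%:R * 2 by rewrite ltr_pM2l//; lra.
  by rewrite (lt_le_trans h)// mulrC.
have := E (Ordinal kK); rewrite /= gb => gb'.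
by move: ga; rewrite ltNge ltW.
Qed.

End grid.

Section pair_class.
Variables (R : realType) (n : nat).

(** (i, false) and (i, true) stand for the i-th coordinates of the two samples. The code is the
    subgraph of [G t] restricted to the grid, encoded as a subset of a finite type so that
    [sauer_shelah] applies. *)
Definition code K (I : Type) (G : I -> 'I_n * bool -> R) (t : I) :
    {set ('I_n * bool) * 'I_K} :=
  [set q : ('I_n * bool) * 'I_K | grid R K q.2 < G t q.1]%SET.

(** [phi] will be the identity for the process and the square for its variance. Passing from t to
    the representative of its code moves each of the two terms of a coordinate by at most 2 (2 / K),
    the Lipschitz constant times the grid step, whence 8 n / K. As a difference of two terms reaches
    2, lam <= 1/2 is what [rademacher_max] needs. *)
Lemma rademacher_pair_class (K : nat) (I : Type) (A : set I)
    (G : I -> 'I_n * bool -> R) (phi : R -> R) (N lam v : R) :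
  (0 < K)%N -> 0 < lam -> lam <= 1 / 2 -> 1 <= N -> 0 <= v ->
  (forall t p, A t -> `|G t p| <= 1) ->
  (forall a b, `|a| <= 1 -> `|b| <= 1 -> `|phi a - phi b| <= 2 * `|a - b|) ->
  (forall a, `|a| <= 1 -> `|phi a| <= `|a|) ->
  (forall F : {set {set ('I_n * bool) * 'I_K}},
     (forall c, c \in F -> exists2 t, A t & c = code K G t) -> #|F|%:R <= N) ->
  (forall t, A t -> \sum_i (G t (i, false) ^+ 2 + G t (i, true) ^+ 2) <= v) ->
  exists2 H : {ffun 'I_n -> bool} -> R,
    forall (e : {ffun 'I_n -> bool}) t, A t ->
      `|\sum_i (-1) ^+ e i * (phi (G t (i, false)) - phi (G t (i, true)))| <= H e &
    2 ^- n * \sum_(e : {ffun 'I_n -> bool}) H e <=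
      ln (2 * N) / lam + 8 * (n%:R / K%:R) + lam * (2 * v).
Proof.
move=> K0 lam0 lam1 N1 v0 G1 philip phile FN Gv.
have N0 : 0 < N by exact: lt_le_trans N1.
have K0' : 0 < K%:R :> R by rewrite ltr0n.
have [A0|/set0P[t0 At0]] := eqVneq A set0.
  exists (fun=> 0); first by move=> e t; rewrite A0.
  rewrite big1// mulr0; apply: addr_ge0; last by rewrite !mulr_ge0// ltW.
  apply: addr_ge0; last by rewrite mulr_ge0// divr_ge0.
  by rewrite divr_ge0 ?ln_ge0 ?(ltW lam0)//; lra.
pose D : pred {set ('I_n * bool) * 'I_K} :=
  fun c => `[< exists2 t, A t & c = code K G t >].
have /choice[rep repP] : forall c : {set ('I_n * bool) * 'I_K}, exists t,
    D c -> A t /\ c = code K G t.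
  move=> c; have [/asboolP[t At ct]|Dc] := boolP (D c); first by exists t.
  by exists t0.
pose a t i := phi (G t (i, false)) - phi (G t (i, true)).
have a2 t i : A t -> `|a t i| <= 2.
  move=> At; apply: le_trans (ler_normB _ _) _.
  have := phile _ (G1 t (i, false) At); have := phile _ (G1 t (i, true) At).
  by have := G1 t (i, false) At; have := G1 t (i, true) At; lra.
have [|c i /repP[At _]|c /repP[At _]|H HD Hc] := @rademacher_max R n _ D
    (fun c => a (rep c)) lam (2 * v) N lam0 N0.
- rewrite sum1_card; have := FN [set c in D]%SET; rewrite cardsE; apply => c.
  by rewrite finset.inE => /asboolP.
- rewrite normrM (ger0_norm (ltW lam0)).
  apply: (@le_trans _ _ (1 / 2 * 2)); last by lra.
  by apply: ler_pM => //; [exact: ltW|exact: a2].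
- apply: (@le_trans _ _ (2 * \sum_i (G (rep c) (i, false) ^+ 2 + G (rep c) (i, true) ^+ 2))).
    rewrite mulr_sumr; apply: ler_sum => i _; rewrite /a.
    have sq x : `|x| <= 1 -> phi x ^+ 2 <= x ^+ 2.
      move=> x1; rewrite -[_ ^+ 2]ger0_norm ?sqr_ge0// -[leRHS]ger0_norm ?sqr_ge0// !normrX.
      by rewrite lerXn2r ?nnegrE// phile.
    have := sq _ (G1 _ (i, false) At); have := sq _ (G1 _ (i, true) At).
    have := sqr_ge0 (phi (G (rep c) (i, false)) + phi (G (rep c) (i, true))).
    by rewrite sqrrD sqrrB; lra.
  by rewrite ler_wpM2l// Gv.
exists (fun e => H e + 8 * (n%:R / K%:R)) => [e t At|].
  pose c := code K G t.
  have Dc : D c by apply/asboolP; exists t.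
  have [Ar cr] := repP c Dc.
  have close p : `|G t p - G (rep c) p| <= 2 / K%:R.
    apply: grid_close => //; [exact: G1|exact: G1|] => k.
    by move/setP: cr => /(_ (p, k)); rewrite !finset.inE.
  have -> : \sum_i (-1) ^+ e i * (phi (G t (i, false)) - phi (G t (i, true))) =
      \sum_i (-1) ^+ e i * a (rep c) i + \sum_i (-1) ^+ e i * (a t i - a (rep c) i).
    by rewrite -big_split/=; apply: eq_bigr => i _; rewrite -mulrDr [a (rep c) i + _]addrC subrK.
  apply: le_trans (ler_normD _ _) _; apply: lerD; first exact: HD.
  apply: le_trans (ler_norm_sum _ _ _) _.
  apply: (@le_trans _ _ (\sum_(i < n) 8 / K%:R)); last first.
    by rewrite sumr_const card_ord -(mulr_natl (8 / K%:R)) mulrCA.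
  apply: ler_sum => i _; rewrite normrM normr_sign mul1r /a.
  have P p : `|phi (G t p) - phi (G (rep c) p)| <= 4 / K%:R.
    apply: le_trans (philip _ _ (G1 _ _ At) (G1 _ _ Ar)) _.
    by have := close p; lra.
  have -> (x y x' y' : R) : x - y - (x' - y') = x - x' - (y - y') by ring.
  apply: le_trans (ler_normB _ _) _.
  by have := P (i, false); have := P (i, true); lra.
rewrite big_split/= mulrDr sumr_const card_ffun card_ord card_bool.
rewrite -(mulr_natr (8 * (n%:R / K%:R))) natrX mulrCA mulVf ?mulr1 ?expf_neq0//.
by rewrite addrAC lerD2r.
Qed.

(** K = n %/ V + 1 keeps the rounding error n / K below V while the m = 2 n K grid points cost only
    a logarithm. If n < V, then K = 1 and the trivial count 2^m, with m = 2 n, is already enough. *)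
Lemma card_codes_le V : (0 < n)%N -> (0 < V)%N -> exists (K : nat) (N : R),
  [/\ (0 < K)%N, 1 <= N,
    forall F : {set {set ('I_n * bool) * 'I_K}},
      (forall J, fshatters F J -> (#|J| < V)%N) -> #|F|%:R <= N &
    ln (2 * N) + n%:R / K%:R <= 5 * V%:R * (1 + logp (n%:R / V%:R))].
Proof.
move=> n0 V0; pose K := (n %/ V).+1; pose m := (n * 2 * K)%N.
have V0' : 0 < V%:R :> R by rewrite ltr0n.
have V1 : 1 <= V%:R :> R by rewrite ler1n.
have cQ : #|{: ('I_n * bool) * 'I_K}| = m.
  by rewrite !card_prod !card_ord card_bool.
have ln2 := ln2_le R.
have [Vn|nV] := leqP V n.
  have Vm : (V <= m)%N.
    by rewrite /m -mulnA (leq_trans Vn)// leq_pmulr.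
  pose N : R := (expR 1 * (m%:R / V%:R)) ^+ V.
  have e1 : 1 <= expR 1 :> R by rewrite -expR0 ler_expR.
  have mV : 1 <= m%:R / V%:R :> R by rewrite ler_pdivlMr// mul1r ler_nat.
  exists K, N; split => //.
  - by rewrite exprn_ege1// (le_trans e1)// ler_peMr ?expR_ge0.
  - move=> F /sauer_shelah; rewrite cQ => FC.
    apply: le_trans (sum_bin_le R V0 Vm); rewrite ler_nat (leq_trans FC)//.
    (* Sauer's sum stops at V - 1; the term of index V is added to match [sum_bin_le]. *)
    by rewrite [leqRHS]big_ord_recr leq_addr.
  have nV1 : 1 <= n%:R / V%:R :> R by rewrite ler_pdivlMr// mul1r ler_nat.
  have l0 : 0 <= ln (n%:R / V%:R) :> R by exact: ln_ge0.
  rewrite /logp max_l//.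
  have KnV : n%:R / V%:R <= K%:R :> R.
    by rewrite ler_pdivrMr// -natrM ler_nat ltnW// ltn_ceil.
  have nK : n%:R / K%:R <= V%:R :> R.
    by rewrite ler_pdivrMr ?ltr0n// mulrC -ler_pdivrMr.
  have K2 : K%:R <= 2 * (n%:R / V%:R) :> R.
    rewrite /K -natr1; have : (n %/ V)%:R <= n%:R / V%:R :> R.
      by rewrite ler_pdivlMr// -natrM ler_nat leq_trunc_div.
    by lra.
  have mle : m%:R / V%:R <= 2 ^+ 2 * (n%:R / V%:R) ^+ 2 :> R.
    rewrite /m !natrM.
    have -> : n%:R * 2 * K%:R / V%:R = 2 * (n%:R / V%:R) * K%:R :> R by field; rewrite gt_eqF.
    have := ler_wpM2l (_ : 0 <= 2 * (n%:R / V%:R)) K2; rewrite -exprMn expr2; apply.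
    by rewrite mulr_ge0// divr_ge0.
  have lm : ln (m%:R / V%:R) <= 2 * ln 2 + 2 * ln (n%:R / V%:R) :> R.
    apply: (@le_trans _ _ (ln (2 ^+ 2 * (n%:R / V%:R) ^+ 2))).
      by rewrite ler_ln// posrE; [lra|rewrite mulr_gt0// exprn_gt0//; lra].
    have nVp : 0 < n%:R / V%:R :> R by lra.
    have ln_sqr (x : R) : 0 < x -> ln (x ^+ 2) = 2 * ln x.
      by move=> x0; rewrite lnXn// mulr_natl.
    by rewrite lnM ?posrE ?exprn_gt0// !ln_sqr.
  have lnN : ln N = V%:R * (1 + ln (m%:R / V%:R)).
    have mV0 : 0 < m%:R / V%:R :> R by exact: lt_le_trans mV.
    rewrite /N lnXn; last exact: mulr_gt0 (expR_gt0 _) mV0.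
    by rewrite lnM ?posrE ?expR_gt0// expRK [RHS]mulr_natl.
  have Npos : 0 < N by rewrite exprn_gt0// mulr_gt0 ?expR_gt0//; lra.
  rewrite lnM ?posrE// lnN.
  have h1 : V%:R * (1 + ln (m%:R / V%:R)) <=
      V%:R * (3 + 2 * ln (n%:R / V%:R)) :> R by rewrite ler_pM2l//; lra.
  have h2 : 0 <= V%:R * ln (n%:R / V%:R) :> R by rewrite mulr_ge0// ltW.
  by lra.
have K1 : K = 1%N by rewrite /K divn_small.
have nV' : n%:R <= V%:R :> R by rewrite ler_nat ltnW.
have l0 : ln (n%:R / V%:R) <= 0 :> R.
  by apply: ln_le0; rewrite ler_pdivrMr// mul1r.
exists K, (2 ^+ m); split => //; first by rewrite exprn_ege1// ler1n.
  move=> F _; rewrite -natrX ler_nat -cQ -cardsT -card_powerset.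
  by apply/subset_leq_card/fintype.subsetP => c _; rewrite finset.powersetE finset.subsetT.
have lm : ln (2 ^+ m) = n%:R * 2 * ln 2 :> R.
  by rewrite lnXn// /m K1 muln1 -(mulr_natl (ln 2)) natrM.
rewrite /logp max_r// addr0 mulr1 lnM ?posrE ?exprn_gt0// lm K1 divr1.
have : ln 2 * n%:R <= 1 * n%:R :> R by rewrite ler_wpM2r//; lra.
by lra.
Qed.

End pair_class.

(** * VC-subgraph models *)

Section vc_model.
Variables (R : realType) (n : nat) (d : 'I_n -> measure_display).
Variable X : forall i, measurableType (d i).
Variable mu : forall i, {measure set (X i) -> \bar R}.
Variable P : dens R X -> probability (sampleType X) R.
Hypothesis lawP : forall s, L0 mu s -> is_law mu s (P s).

(** V elements of a shattered [J] are V sample points with thresholds for psi; monotonicity in t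
    lets [shatters_subgraph] turn them into thresholds for t itself. Several elements of [J] may lie
    over one sample point, and the two samples may share coordinates, so [pt] is not assumed
    injective. *)
Lemma fshatters_codes_lt (A : set (dens R X)) (sb : dens R X) V K
    (pt : 'I_n * bool -> {i : 'I_n & X i})
    (G := fun (t : dens R X) p =>
       psi_comp sb t (i := projT1 (pt p)) (projT2 (pt p)))
    (F : {set {set ('I_n * bool) * 'I_K}}) (J : {set ('I_n * bool) * 'I_K}) :
  A `<=` L0 mu -> L0 mu sb ->
  (~ exists B, (B #= `I_V)%card /\
     shatters [set subgraph f | f in [set flat t | t in A]] B) ->
  (forall c, c \in F -> exists2 t, A t & c = code K G t) ->
  fshatters F J -> (#|J| < V)%N.
Proof.
move=> AL Lsb NV FA /fshattersP shJ; rewrite ltnNge; apply/negP => VJ; apply: NV.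
pose p (k : 'I_V) := enum_val (widen_ord VJ k).
have pJ k : p k \in J by exact: enum_valP.
have p_inj : injective p.
  by move=> k k' /enum_val_inj /(congr1 val) /= e; exact: val_inj.
pose h (t : dens R X) (w : {i : 'I_n & X i}) : R := t (projT1 w) (projT2 w).
apply: (@shatters_subgraph R _ _ A h V (fun k => pt (p k).1)
    (fun t k => grid R K (p k).2 < G t (p k).1)).
- move=> t t' k At At' le lt; apply: (lt_le_trans lt).
  have [_ t0 _] := AL t At (projT1 (pt (p k).1)).
  have [_ sb0 _] := Lsb (projT1 (pt (p k).1)).
  exact: psi_ediv_mono.
- move=> B; have BJ : (p @: B)%SET \subset J.
    by apply/fintype.subsetP => _ /imsetP[k _ ->].
  have [c /FA[t At ->] cJ] := shJ _ BJ; exists t => // k.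
  rewrite -(mem_imset _ _ p_inj) -cJ !finset.inE pJ andbT.
  by [].
Qed.

Variables (S : set (dens R X)) (s sb : dens R X) (y : R) (V K : nat) (N : R).
Hypotheses (SL : S `<=` L0 mu) (cS : countable S) (Ls : L0 mu s) (Lsb : L0 mu sb).
Hypothesis NV : ~ exists B, (B #= `I_V)%card /\
  shatters [set subgraph f | f in [set flat t | t in S]] B.
Hypotheses (K0 : (0 < K)%N) (N1 : 1 <= N).
Hypothesis NF : forall F : {set {set ('I_n * bool) * 'I_K}},
  (forall J, fshatters F J -> (#|J| < V)%N) -> #|F|%:R <= N.

Let A := BS mu S s sb y.
Let AS : A `<=` S. Proof. by move=> t []. Qed.
Let AL : A `<=` L0 mu. Proof. by move=> t /AS/SL. Qed.
Let cA : countable A.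
Proof. by apply: sub_countable cS; exact: subset_card_le. Qed.

Let q t (x : sampleType X) := \sum_(i < n) psi_comp sb t (x i) ^+ 2.
(** The empirical variance of the process; its real version [v] is faithful because [q t x] <= n. *)
Let V2 x := esup [set (q t x)%:E | t in A].
Let v x : R := fine (V2 x).

Let q_bnd t x : A t -> 0 <= q t x <= n%:R.
Proof.
move=> At; rewrite sumr_ge0 => [|i _]; last by rewrite sqr_ge0.
rewrite -[n in n%:R]card_ord -sumr_const /=; apply: ler_sum => i _.
rewrite -[leLHS]ger0_norm ?sqr_ge0// normrX exprn_ile1//.
by apply: psi_comp_norm_le1 => //; exact: AL.
Qed.

Let V2E x : V2 x = (v x)%:E.
Proof.
rewrite /v fineK// ge0_fin_numE; last first.
  by apply: esup_ge0 => _ [t At <-]; rewrite lee_fin; case/andP: (q_bnd x At).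
apply: (@le_lt_trans _ _ n%:R%:E); last exact: ltry.
apply: esup_le; first by rewrite lee_fin.
by move=> _ [t At <-]; rewrite lee_fin; case/andP: (q_bnd x At).
Qed.

Let v_bnd x : 0 <= v x <= n%:R.
Proof.
rewrite -!lee_fin -V2E; apply/andP; split.
  by apply: esup_ge0 => _ [t At <-]; rewrite lee_fin; case/andP: (q_bnd x At).
apply: esup_le; first by rewrite lee_fin.
by move=> _ [t At <-]; rewrite lee_fin; case/andP: (q_bnd x At).
Qed.

Let q_le_v t x : A t -> q t x <= v x.
Proof. by move=> At; rewrite -lee_fin -V2E; apply: esup_ub; exists t. Qed.

Let mpsi t i : A t -> measurable_fun setT (psi_comp sb t (i := i)).
Proof. by move=> At; apply: (measurable_psi_comp (mu := mu)) => //; exact: AL. Qed.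

Let mpsix t i : A t -> measurable_fun setT (fun x : sampleType X => psi_comp sb t (x i)).
Proof.
by move=> At; have h := measurableT_comp (@mpsi t i At) (measurable_coord (i := i)); exact: h.
Qed.

Let mv : measurable_fun setT v.
Proof.
apply/measurable_EFinP; rewrite (_ : EFin \o v = V2); last first.
  by apply/funext => x /=; rewrite V2E.
apply: measurable_esup => // t At; apply/measurable_EFinP.
by apply: measurable_sum => i; apply: measurable_funX; exact: mpsix.
Qed.

Let expected_sup_le (phi : R -> R) (lam : R) : measurable_fun setT phi ->
  (forall a b, `|a| <= 1 -> `|b| <= 1 -> `|phi a - phi b| <= 2 * `|a - b|) ->
  (forall a, `|a| <= 1 -> `|phi a| <= `|a|) ->
  0 < lam -> lam <= 1 / 2 ->
  (\int[P s]_x esup [set `|\sum_i (phi (psi_comp sb t (x i)) -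
      \int[P s]_z phi (psi_comp sb t (z i)))|%:E | t in A] <=
   (ln (2 * N) / lam + 8 * (n%:R / K%:R) + 2 * (2 * lam) * \int[P s]_x v x)%:E)%E.
Proof.
move=> mphi philip phile lam0 lam1.
have psi1 t i z : A t -> `|psi_comp sb t (i := i) z| <= 1.
  by move=> At; apply: psi_comp_norm_le1 => //; exact: AL.
apply: (symmetrized_expectation_le (law_rectangle Ls (lawP Ls)) (M := n%:R)
  (f := fun t i z => phi (psi_comp sb t (i := i) z))) => //.
- by move=> t i At; apply: measurableT_comp => //; exact: mpsi.
- move=> t i z At; apply: le_trans (phile _ (psi1 t i z At)) _.
  exact: psi1.
- apply: addr_ge0; last by apply: mulr_ge0 => //; exact: divr_ge0.
  by rewrite divr_ge0 ?ln_ge0 ?(ltW lam0)//; have := N1; lra.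
- by rewrite mulr_ge0// ltW.
move=> x z; pose pt (p : 'I_n * bool) : {i : 'I_n & X i} :=
  existT _ p.1 (if p.2 then z p.1 else x p.1).
pose G (t : dens R X) p := psi_comp sb t (i := projT1 (pt p)) (projT2 (pt p)).
have [||||||H HD Hc] := @rademacher_pair_class R n K _ A G phi N lam (v x + v z)
    K0 lam0 lam1 N1.
- by rewrite addr_ge0//; [case/andP: (v_bnd x)|case/andP: (v_bnd z)].
- by move=> t p At; exact: psi1.
- exact: philip.
- exact: phile.
- move=> F FA; apply: NF => J.
  apply: (@fshatters_codes_lt A sb V K pt F J AL Lsb _ FA).
  move=> [B [BV Bsh]]; apply: NV; exists B; split => // C CB.
  have [_ [_ [t At <-] <-] tC] := Bsh C CB.
  by exists (subgraph (flat t)) => //; exists (flat t) => //; exists t => //; exact: AS.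
- by move=> t At; rewrite big_split/=; apply: lerD; exact: q_le_v.
exists H; first by move=> e t At; exact: HD.
by apply: le_trans Hc _; rewrite lerD2l mulrCA mulrA.
Qed.

(* [phi a = a ^+ 2], whose deviations are again controlled by [v] itself *)
Let Ev_le (L := ln (2 * N)) :
  \int[P s]_x v x <= 6 * y ^+ 2 + 16 * L + 16 * (n%:R / K%:R).
Proof.
have vi : (P s).-integrable setT (EFin \o v).
  apply: (@integrable_bounded _ _ _ _ _ n%:R) => // x.
  by rewrite ger0_norm//; case/andP: (v_bnd x).
have msqr : measurable_fun setT (fun a : R => a ^+ 2) by exact: measurable_funX.
have sqr_lip (a b : R) : `|a| <= 1 -> `|b| <= 1 -> `|a ^+ 2 - b ^+ 2| <= 2 * `|a - b|.
  move=> a1 b1; rewrite subr_sqr normrM mulrC ler_wpM2r//.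
  by apply: le_trans (ler_normD _ _) _; lra.
have sqr_le (a : R) : `|a| <= 1 -> `|a ^+ 2| <= `|a|.
  by move=> a1; rewrite normrX expr2 ler_piMl.
(* At lam = 1/8 the coefficient 2 (2 lam) of E v is 1/2, so this term is absorbed by the left-hand
   side and every other one doubles. *)
have l8 : 0 < 1 / 8 :> R by lra.
have l82 : 1 / 8 <= 1 / 2 :> R by lra.
have H := @expected_sup_le (fun a => a ^+ 2) (1 / 8) msqr sqr_lip sqr_le l8 l82.
set W := (fun x => esup _) in H.
have W0 x : (0 <= W x)%E by apply: esup_ge0 => _ [t _ <-]; rewrite lee_fin.
have mW : measurable_fun setT W.
  apply: measurable_esup => // t At; apply/measurable_EFinP.
  apply: measurableT_comp => //; apply: measurable_sum => i.
  by apply: measurable_funB => //; apply: measurable_funX; exact: mpsix.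
suff : ((\int[P s]_x v x)%:E <= (3 * y ^+ 2)%:E + \int[P s]_x W x)%E.
  move=> h; have := le_trans h (leeD (lexx _) H); rewrite -EFinD lee_fin.
  by rewrite /L; lra.
rewrite EFin_Rintegral//.
have -> : ((3 * y ^+ 2)%:E + \int[P s]_x W x = \int[P s]_x ((3 * y ^+ 2)%:E + W x))%E.
  rewrite ge0_integralD//; first by rewrite integral_cst_probability.
  by move=> x _; rewrite lee_fin mulr_ge0// sqr_ge0.
apply: ge0_le_integral => //.
- by move=> x _; rewrite lee_fin; case/andP: (v_bnd x).
- exact/measurable_EFinP.
- exact: emeasurable_funD.
move=> x _; rewrite -V2E; apply: esup_le.
  by rewrite adde_ge0// lee_fin mulr_ge0// sqr_ge0.
move=> _ [t At <-].
have qE : \sum_(i < n) \int[P s]_z psi_comp sb t (z i) ^+ 2 <= 3 * y ^+ 2.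
  apply: le_trans (sum_Rintegral_psi_ratio_sqr_le lawP Ls Lsb (AL At)) _.
  by rewrite ler_wpM2l//; case: At.
apply: (@le_trans _ _ ((3 * y ^+ 2)%:E + (`|\sum_i (psi_comp sb t (x i) ^+ 2 -
      \int[P s]_z psi_comp sb t (z i) ^+ 2)|)%:E)%E).
  rewrite -EFinD lee_fin sumrB.
  by have := ler_norm (q t x - \sum_(i < n) \int[P s]_z psi_comp sb t (z i) ^+ 2); rewrite /q; lra.
by apply: leeD => //; apply: esup_ub; exists t.
Qed.

Lemma wS_vc_le :
  (wS mu P S s sb y <=
   (c0 R / 2 * y ^+ 2 + (48 / c0 R + 10) * (ln (2 * N) + n%:R / K%:R))%:E)%E.
Proof.
have c00 := c0_gt0 R; have c08 := c0_le R.
(* The variance enters as 4 lam E v, and E v contributes 6 y^2: lam = c0 / 48 turns this into c0 / 2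
   y^2. *)
have lam0 : 0 < c0 R / 48 by rewrite divr_gt0.
have lam1 : c0 R / 48 <= 1 / 2 by lra.
have id_lip (a b : R) : `|a| <= 1 -> `|b| <= 1 -> `|a - b| <= 2 * `|a - b|.
  by move=> _ _; have := normr_ge0 (a - b); lra.
have H := @expected_sup_le id (c0 R / 48) (@measurable_id _ _ _) id_lip
  (fun a _ => lexx _) lam0 lam1.
apply: le_trans H _; rewrite lee_fin.
have l0 : 0 <= ln (2 * N) by apply: ln_ge0; have := N1; lra.
have nK0 : 0 <= n%:R / K%:R :> R by rewrite divr_ge0.
have := ler_wpM2l (ltW lam0) Ev_le.
have c0i : 0 < (c0 R)^-1 by rewrite invr_gt0.
have -> : ln (2 * N) / (c0 R / 48) = 48 * ((c0 R)^-1 * ln (2 * N)).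
  by field; rewrite gt_eqF.
have : 0 <= (c0 R)^-1 * (n%:R / K%:R) by rewrite mulr_ge0// ltW.
have : c0 R * ln (2 * N) <= 8^-1 * ln (2 * N) by rewrite ler_wpM2r.
have : c0 R * (n%:R / K%:R) <= 8^-1 * (n%:R / K%:R) by rewrite ler_wpM2r.
have -> : (48 / c0 R + 10) * (ln (2 * N) + n%:R / K%:R) =
  48 * ((c0 R)^-1 * ln (2 * N)) + 48 * ((c0 R)^-1 * (n%:R / K%:R))
  + 10 * ln (2 * N) + 10 * (n%:R / K%:R) by ring.
by lra.
Qed.

End vc_model.

(** * Dimension of VC-subgraph models and risk bounds *)

Section dimension_bounds.
Variables (R : realType) (n : nat) (d : 'I_n -> measure_display).
Variable X : forall i, measurableType (d i).
Variable mu : forall i, {measure set (X i) -> \bar R}.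
Variable P : dens R X -> probability (sampleType X) R.
Hypothesis lawP : forall s, L0 mu s -> is_law mu s (P s).
Implicit Types Sb : set (dens R X).

(** A nonempty class shatters the empty set. *)
Lemma vc_index_gt0 (T : Type) (C : set (set T)) V :
  C !=set0 -> vc_index C V -> (0 < V)%N.
Proof.
move=> [c Cc] [NV _]; rewrite lt0n; apply/eqP => V0; apply: NV.
exists set0; split; first by rewrite V0 II0.
by move=> B; rewrite subset0 => ->; exists c => //; rewrite setI0.
Qed.

(* D^S <= b as soon as c0 / 2 * b bounds the second term of [wS_vc_le]. *)
Definition vc_const : R := c2 R * (2 / c0 R * (48 / c0 R + 10) * 5).

Lemma vc_const_gt0 : 0 < vc_const.
Proof.
have c00 := c0_gt0 R; have c20 := c2_gt0 R.
have c0i : 0 < 48 / c0 R by rewrite divr_gt0.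
rewrite /vc_const mulr_gt0// mulr_gt0// mulr_gt0 ?divr_gt0//; lra.
Qed.

Lemma Dmodel_vc_le Sb V : (0 < n)%N -> is_model mu Sb ->
  vc_subgraph_index [set flat t | t in Sb] V ->
  (Dmodel mu P Sb <= (vc_const * V%:R * (1 + logp (n%:R / V%:R)))%:E)%E.
Proof.
move=> n0 [SbL [t0 Sbt0] [D [DSb cD Ddense]]] hV.
have V0 : (0 < V)%N.
  apply: vc_index_gt0 hV; exists (subgraph (flat t0)), (flat t0) => //.
  by exists t0.
have [K [N [K0 N1 NF hKN]]] := card_codes_le R n0 V0.
have [S [SD iS hS]] := exists_identifiable_subset (subset_trans DSb SbL) cD.
have [SL cS _] := iS.
set l := 1 + logp (n%:R / V%:R) in hKN *.
have l1 : 1 <= l by rewrite /l lerDl /logp le_max lexx orbT.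
have Vl : 1 <= V%:R * l by rewrite -[leLHS]mulr1 ler_pM// ler1n.
have c00 := c0_gt0 R; have c08 := c0_le R.
have c0i : 8 <= (c0 R)^-1 by rewrite -[8]invrK lef_pV2 ?posrE.
pose b := 2 / c0 R * (48 / c0 R + 10) * (5 * (V%:R * l)).
(* [S] is at distance zero from every element of [Sb], by density of [D], so the approximation
   radius is 0. *)
rewrite [leRHS](_ : _ = (2 * c1 R * 0 ^+ 2 + c2 R * b)%:E); last first.
  by congr EFin; rewrite /b /vc_const; ring.
apply: (Dmodel_le iS) => //.
  move=> t Sbt; rewrite hS; last exact: SbL.
  apply/lee_addgt0Pr => e e0; rewrite add0e.
  have [u Du tu] := Ddense t Sbt e e0.
  apply: (@le_trans _ _ (hdist mu t u)%:E); last by rewrite lee_fin ltW.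
  by apply: ereal_inf_lbound; exists u.
apply: DS_le.
  have h : 1 <= (c0 R)^-1 * (48 * (c0 R)^-1 + 10) by nra.
  by rewrite /b; nra.
move=> s sb y Ls Ssb y0 by_.
have NV : ~ exists B, (B #= `I_V)%card /\
    shatters [set subgraph f | f in [set flat t | t in S]] B.
  move=> [B [BV Bsh]]; case: hV => NV _; apply: NV; exists B; split => // C CB.
  have [_ [_ [t St <-] <-] tC] := Bsh C CB.
  by exists (subgraph (flat t)) => //; exists (flat t) => //; exists t => //;
    apply/DSb/SD.
have hw := wS_vc_le lawP y SL cS Ls (SL _ Ssb) NV K0 N1 NF.
apply: (le_trans hw).
rewrite lee_fin.
have c48 : 0 <= 48 / c0 R + 10 by rewrite addr_ge0// divr_ge0// ltW.
have h1 := ler_wpM2l c48 hKN.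
have h2 : c0 R / 2 * b <= c0 R / 2 * y ^+ 2.
  by rewrite ler_wpM2l ?divr_ge0 ?(ltW c00)// ltW.
have h3 : c0 R / 2 * b = (48 / c0 R + 10) * (5 * V%:R * l).
  by rewrite /b; field; rewrite gt_eqF.
by lra.
Qed.

Lemma hset_self Sb t : L0 mu t -> Sb t -> hset mu t Sb = 0%E.
Proof.
move=> Lt St; apply/eqP; rewrite eq_le hset_ge0 andbT.
apply: (@le_trans _ _ (hdist mu t t)%:E); last by rewrite hdistxx.
by apply: ereal_inf_lbound; exists t.
Qed.

Lemma minimax_risk_le Sb shat : risk_rho_estimator mu P Sb shat ->
  (minimax_risk mu P Sb <= max_risk mu P Sb shat)%E.
Proof.
by move=> [[S [_ est _]] _]; apply: ereal_inf_lbound; exists shat.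
Qed.

Lemma max_risk_le Sb shat (D : R) : Sb `<=` L0 mu ->
  risk_rho_estimator mu P Sb shat -> 0 <= D ->
  (Dmodel mu P Sb <= D%:E)%E ->
  (max_risk mu P Sb shat <= (c4 R + D)%:E)%E.
Proof.
move=> SbL [_ hrisk] D0 hD.
have c40 : 0 <= c4 R.
  by rewrite /c4 /c3 /kappa; have := c2_gt0 R; lra.
apply: esup_le; first by rewrite lee_fin addr_ge0.
move=> _ [s Ss <-]; have Ls := SbL _ Ss.
apply: (le_trans (hrisk s Ls)).
rewrite (hset_self Ls Ss) expe2 !mule0 add0e addeC.
rewrite [leRHS](_ : _ = (c4 R)%:E + D%:E)%E//.
exact: leeD.
Qed.

End dimension_bounds.

Theorem corollary16 (R : realType) :
  exists2 C : R, 0 < C &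
  forall (n : nat) (d : 'I_n -> measure_display)
    (X : forall i, measurableType (d i))
    (mu : forall i, {measure set (X i) -> \bar R})
    (P : dens R X -> probability (sampleType X) R)
    (Sbar : set (dens R X)) (shat : sampleType X -> dens R X),
  (3 <= n)%N ->
  (forall s, L0 mu s -> is_law mu s (P s)) ->
  is_model mu Sbar ->
  risk_rho_estimator mu P Sbar shat ->
  (forall V : nat,
     vc_subgraph_index [set flat t | t in Sbar] V ->
     (minimax_risk mu P Sbar <= max_risk mu P Sbar shat)%E /\
     (max_risk mu P Sbar shat <=
       (c4 R + C * V%:R * (1 + logp (n%:R / V%:R)))%:E)%E)
  /\
  (forall Dt : R -> \bar R,
     dimension_function n Dt ->
     htotally_bounded mu Sbar ->
     metric_dimension_bounded mu Sbar Dt ->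
     (minimax_risk mu P Sbar <= max_risk mu P Sbar shat)%E /\
     (max_risk mu P Sbar shat <=
       (c4 R + 2 * (c1 R + 2 * c2 R) * etabar Dt ^+ 2)%:E)%E).
Proof.
exists (vc_const R); first exact: vc_const_gt0.
move=> n d X mu P Sb shat n3 lawP modelS rhoS; have [SbL _ _] := modelS.
have n0 : (0 < n)%N by exact: leq_trans n3.
split=> [V hV|Dt hDt _ hSb]; (split; first exact: minimax_risk_le rhoS).
  apply: (max_risk_le SbL rhoS); last exact: Dmodel_vc_le hV.
  apply: mulr_ge0; first by rewrite mulr_ge0// ltW// vc_const_gt0.
  by rewrite addr_ge0// /logp le_max lexx orbT.
apply: (max_risk_le SbL rhoS); last exact: Dmodel_etabar_le hSb.
rewrite mulr_ge0 ?sqr_ge0// mulr_ge0// addr_ge0 ?c1_ge0// mulr_ge0//.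
by rewrite ltW// c2_gt0.
Qed.
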